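(* Let $R,S\subseteq\mathbb{N}^\mathbb{N}$ both be endowed with $\sigma$-finite Borel measures and let $I,J$ be intervals such that $\infty$ is not an open endpoint of $I$. Then $\mathsf{P}_I\mathsf{C}_R*\mathsf{P}_J\mathsf{C}_S\le_W\mathsf{P}_{I\cdot J}\mathsf{C}_{R\times S}$, where $R\times S$ carries the product measure and $I\cdot J=\{xy:x\in I,y\in J\}$ (with the conventions $0\cdot\infty=0$ and $x\cdot\infty=\infty$ for $x>0$).
   Context: A represented space is a pair $(X,\delta_X)$ where $\delta_X:\subseteq\mathbb{N}^\mathbb{N}\to X$ is a partial surjection; subsets of $\mathbb{N}^\mathbb{N}$ are represented by the identity and pairs by the standard pairing $\langle p,q\rangle(2k)=p(k)$, $\langle p,q\rangle(2k+1)=q(k)$. Problems are partial multi-valued functions. A realizer of $f:\subseteq X\rightrightarrows Y$ is a partial $F:\subseteq\mathbb{N}^\mathbb{N}\to\mathbb{N}^\mathbb{N}$ with $\delta_Y F(p)\in f(\delta_X(p))$ for all $p\in\mathrm{dom}(f\circ\delta_X)$. $f\le_W g$ if there are computable partial $H,K$ such that $p\mapsto H\langle p,GK(p)\rangle$ realizes $f$ for every realizer $G$ of $g$. The compositional product $f*g$ is the Weihrauch degree which is the maximum with respect to $\le_W$ of all compositions $f_0\circ g_0$ with $f_0\le_W f$ and $g_0\le_W g$ (this maximum exists); $f*g\le_W h$ means every such composition is $\le_W h$. Sierpiński space $\mathbb{S}=\{0,1\}$ is represented by $\delta_{\mathbb S}(p)=0$ iff $p$ is constantly zero. $\mathcal{A}_-(X)$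 denotes the closed subsets of $X$ represented by negative information (a name of $A$ is a name of the characteristic function $X\to\mathbb S$ of $X\setminus A$). An interval is an interval of reals with open or closed endpoints, where $\infty$ is allowed as right endpoint, but $[\infty,\infty]$ is not an interval. If $X$ carries a Borel measure $\mu$, probabilistic choice $\mathsf{P}_I\mathsf{C}_X:\subseteq\mathcal{A}_-(X)\rightrightarrows X$, $A\mapsto A$, is defined on all nonempty closed $A$ with $\mu(A)\in I$. *)

(* Defs.v *)
From mathcomp Require Import all_boot all_algebra.
From mathcomp Require Import all_classical all_reals all_analysis.

Set Implicit Arguments.
Unset Strict Implicit.
Unset Printing Implicit Defensive.

Import GRing.Theory Num.Theory.
Local Open Scope classical_set_scope.
Local Open Scope ring_scope.

Definition baire : Type := prod_topology (fun _ : nat => nat).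

Definition borel_baire := g_sigma_algebraType (open : set (set baire)).

Definition bpair (p q : baire) : baire :=
  fun n => if odd n then q n./2 else p n./2.
Definition bfst (r : baire) : baire := fun k => r k.*2.
Definition bsnd (r : baire) : baire := fun k => r k.*2.+1.

Inductive oterm : Type :=
| OZero
| OSucc
| OProj of nat
| OOracle
| OComp of oterm & list oterm
| ORec of oterm & oterm
| OMu of oterm.

Inductive oeval (p : nat -> nat) : oterm -> seq nat -> nat -> Prop :=
| oev_zero xs : oeval p OZero xs 0
| oev_succ xs : oeval p OSucc xs (head 0 xs).+1
| oev_proj i xs : oeval p (OProj i) xs (nth 0 xs i)
| oev_oracle xs : oeval p OOracle xs (p (head 0 xs))
| oev_comp f gs xs ys v :
    oevals p gs xs ys -> oeval p f ys v -> oeval p (OComp f gs) xs v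
| oev_rec0 f g ys v : oeval p f ys v -> oeval p (ORec f g) (0 :: ys) v
| oev_recS f g k ys w v :
    oeval p (ORec f g) (k :: ys) w -> oeval p g (k :: w :: ys) v ->
    oeval p (ORec f g) (k.+1 :: ys) v
| oev_mu f xs n :
    oeval p f (n :: xs) 0 ->
    (forall m, (m < n)%N -> exists v, oeval p f (m :: xs) v.+1) ->
    oeval p (OMu f) xs n
with oevals (p : nat -> nat) : list oterm -> seq nat -> seq nat -> Prop :=
| oevs_nil xs : oevals p nil xs [::]
| oevs_cons g gs xs y ys :
    oeval p g xs y -> oevals p gs xs ys -> oevals p (g :: gs) xs (y :: ys).

Definition pfun := baire -> option baire.

Definition computable (F : pfun) : Prop :=
  exists t : oterm, forall p q, F p = Some q -> forall n, oeval p t [:: n] (q n).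

Record rep_space := RepSpace {
  rcar :> Type;
  rdelta : baire -> rcar -> Prop;
  rdelta_fun : forall p x y, rdelta p x -> rdelta p y -> x = y;
  rdelta_surj : forall x, exists p, rdelta p x
}.

(* A problem f :subseteq X =>> Y is a relation; dom f = {x | f x <> empty}. *)
Definition problem (X Y : Type) := X -> Y -> Prop.

Definition realizes {X Y : Type} (dX : baire -> X -> Prop)
    (dY : baire -> Y -> Prop) (f : problem X Y) (F : pfun) : Prop :=
  forall p x, dX p x -> (exists y, f x y) ->
    exists q y, F p = Some q /\ dY q y /\ f x y.

Definition wred {X Y X' Y' : Type}
    (dX : baire -> X -> Prop) (dY : baire -> Y -> Prop) (f : problem X Y)
    (dX' : baire -> X' -> Prop) (dY' : baire -> Y' -> Prop) (g : problem X' Y')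
  : Prop :=
  exists H K : pfun, computable H /\ computable K /\
    forall G : pfun, realizes dX' dY' g G ->
      realizes dX dY f
        (fun p => obind (fun q => obind (fun r => H (bpair p r)) (G q)) (K p)).

Definition pcomp {X Y Z : Type} (f : problem Y Z) (g : problem X Y)
  : problem X Z :=
  fun x z => (forall y, g x y -> exists z', f y z') /\
             exists y, g x y /\ f y z.

Definition cprod_wred {Xf Yf Xg Yg Xh Yh : Type}
    (dXf : baire -> Xf -> Prop) (dYf : baire -> Yf -> Prop) (f : problem Xf Yf)
    (dXg : baire -> Xg -> Prop) (dYg : baire -> Yg -> Prop) (g : problem Xg Yg)
    (dXh : baire -> Xh -> Prop) (dYh : baire -> Yh -> Prop) (h : problem Xh Yh)
  : Prop :=
  forall (X Y Z : rep_space) (f0 : problem Y Z) (g0 : problem X Y),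
    wred (@rdelta Y) (@rdelta Z) f0 dXf dYf f ->
    wred (@rdelta X) (@rdelta Y) g0 dXg dYg g ->
    wred (@rdelta X) (@rdelta Z) (pcomp f0 g0) dXh dYh h.

Definition dsub (R : set baire) : baire -> baire -> Prop :=
  fun p x => R p /\ x = p.

Definition dprod {X Y : Type} (dX : baire -> X -> Prop) (dY : baire -> Y -> Prop)
  : baire -> X * Y -> Prop :=
  fun r xy => dX (bfst r) xy.1 /\ dY (bsnd r) xy.2.

Definition dsier : baire -> bool -> Prop :=
  fun p b => b = ~~ `[< forall n, p n = 0 >].

(* Weihrauch's standard representation eta of partial continuous functions
   on Baire space (Kleene-associate style): eta_p(r) = q iff for every n
   there is m with p(<n, r|m>) = q(n)+1 and p(<n, r|m'>) = 0 for m' < m.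
   Here <n, w> is the canonical (injective, computable) code of
   (n, w) : nat * seq nat. *)
Definition eta (p r q : baire) : Prop :=
  forall n, exists m,
    p (pickle (n, mkseq r m)) = (q n).+1 /\
    forall m', (m' < m)%N -> p (pickle (n, mkseq r m')) = 0.

Definition dfunS {X : Type} (dX : baire -> X -> Prop)
  : baire -> (X -> bool) -> Prop :=
  fun p chi => forall r x, dX r x -> exists q, eta p r q /\ dsier q (chi x).

(* A_-(X): a name of the closed set A is a name of the characteristic
   function X -> S of X \ A.  Sets A are taken as subsets of the image
   of dX. *)
Definition dneg {X : Type} (dX : baire -> X -> Prop)
  : baire -> set X -> Prop :=
  fun p A => (forall x, A x -> exists r, dX r x) /\
             dfunS dX p (fun x => `[< ~ A x >]).

(* An interval: real left endpoint, right endpoint real or infinity (None),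
   each endpoint open or closed. ([oo,oo] is thus excluded.) *)
Record xinterval (K : realType) := XInterval {
  ilo : K;
  ilo_closed : bool;
  ihi : option K;
  ihi_closed : bool
}.

Definition in_interval {K : realType} (I : xinterval K) (x : \bar K) : Prop :=
  (if ilo_closed I then ((ilo I)%:E <= x)%E else ((ilo I)%:E < x)%E) /\
  (let hi := if ihi I is Some b then b%:E else +oo%E in
   if ihi_closed I then (x <= hi)%E else (x < hi)%E).

Definition infty_open {K : realType} (I : xinterval K) : Prop :=
  ihi I = None /\ ihi_closed I = false.

(* I . J = {xy | x in I, y in J}, product in the extended reals
   (0 * oo = 0, x * oo = oo for x > 0). *)
Definition in_interval_prod {K : realType} (I J : xinterval K) (z : \bar K)
  : Prop :=
  exists x y, in_interval I x /\ in_interval J y /\ z = (x * y)%E.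

(* A Borel measure mu on the subspace R of N^N is encoded by the measure
   nu(B) := mu(B n R) on the Borel sets of N^N; such nu are exactly the
   measures vanishing on Borel sets disjoint from R, and mu(B n R) = nu(B). *)
Definition concentrated_on {K : realType}
    (nu : {measure set borel_baire -> \bar K}) (R : set baire) : Prop :=
  forall B : set borel_baire, measurable B -> B `&` R = set0 -> nu B = 0%E.

Definition closed_in (R : set baire) (A : set baire) : Prop :=
  exists C : set baire, closed C /\ A = C `&` R.

Definition closed_in2 (R S : set baire) (A : set (baire * baire)) : Prop :=
  exists C : set (baire * baire), closed C /\ A = C `&` (R `*` S).

(* Probabilistic choice P_I C_R : A_-(R) =>> R,  A |-> A, on nonempty
   closed A with mu(A) in I; mu(A) = nu(B) for any Borel B with B n R = A. *)
Definition PC {K : realType} (I : \bar K -> Prop)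
    (R : set baire) (nu : {measure set borel_baire -> \bar K})
  : problem (set baire) baire :=
  fun A x => closed_in R A /\
    (exists B : set borel_baire, measurable B /\ B `&` R = A /\ I (nu B)) /\
    A x.

Definition PC2 {K : realType} (I : \bar K -> Prop)
    (R S : set baire) (nuR nuS : {measure set borel_baire -> \bar K})
  : problem (set (baire * baire)) (baire * baire) :=
  fun A x => closed_in2 R S A /\
    (exists C : set (borel_baire * borel_baire),
        measurable C /\ C `&` (R `*` S) = A /\ I ((nuR \x nuS)%E C)) /\
    A x.

(* Main.v *)
From Pilot Require Import Defs.
From HB Require Import structures.
From mathcomp Require Import all_boot all_order all_algebra.
From mathcomp Require Import all_classical all_reals all_analysis.
From mathcomp Require Import measurable_realfun.

(** Let the problem applied first send a name [p] to a closed set [A] in [S], and let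
each point [s] of [A] yield, through the other problem, a closed set [B_s] in
[R].  The set [C = {(r, s) | s in A, r in B_s}] is closed, uniformly in [p]: a pair
[(r, s)] is rejected as soon as [A] rejects [s] or [B_s] rejects [r].  The second
test may run forever when [s] is not in [A], so the two are dovetailed with a
fuel-bounded evaluator.  By Tonelli the measure of [C] is the integral over [A] of
[s |-> nuR (B_s)], a function with values in [I]; by the mean value theorem this is
[c * nuS A] with [c] in [I] when [nuS A] is finite and positive.  If [nuS A = 0], so
is the integral.  If [nuS A = +oo] then [J] contains all large reals, and a positive
finite integral forces [I] to contain all small positive reals. *)

Set Implicit Arguments.
Unset Strict Implicit.
Unset Printing Implicit Defensive.

Import Order.TTheory GRing.Theory Num.Theory.
Local Open Scope nat_scope.

(* Hierarchy-Builder has another [eta]. *)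
Local Notation eta := Pilot.Defs.eta.

(** * Uniformly computable functions *)

Fixpoint prec (b : nat) (s : nat -> nat -> nat) (k : nat) : nat :=
  if k is k'.+1 then s k' (prec b s k') else b.

Lemma eq_prec b s s' k :
  (forall j acc, s j acc = s' j acc) -> prec b s k = prec b s' k.
Proof. by move=> ss'; elim: k => //= k ->. Qed.

Section UniformlyComputable.
Variables (P : Type) (o : P -> baire).
Implicit Types (a b i : nat) (f g : P -> seq nat -> nat).

(** A single term serves all parameters [x]. With [P] a type of inputs bundled with proofs of
    definedness, partial functions become total ones on [P]. *)
Definition cf a f : Prop :=
  exists t, forall x xs, size xs = a -> oeval (o x) t xs (f x xs).

Lemma cf_ext a f g :
  (forall x xs, size xs = a -> f x xs = g x xs) -> cf a f -> cf a g.
Proof. by move=> fg [t tP]; exists t => x xs sx; rewrite -fg //; exact: tP. Qed.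

Lemma cf_proj a i : cf a (fun _ xs => nth 0 xs i).
Proof. by exists (OProj i) => x xs _; constructor. Qed.


Lemma cf_comp a f (gs : seq (P -> seq nat -> nat)) :
  cf (size gs) f ->
  (forall i, i < size gs -> cf a (nth (fun _ _ => 0) gs i)) ->
  cf a (fun x xs => f x [seq g x xs | g <- gs]).
Proof.
move=> [t tP] H.
have [ts tsP] : exists ts, forall x xs, size xs = a ->
    oevals (o x) ts xs [seq g x xs | g <- gs].
  elim: gs H {tP} => [|g gs IH] H; first by exists [::] => y xs _; constructor.
  have [ts tsP] := IH (fun i => H i.+1).
  have [u uP] := H 0 isT.
  by exists (u :: ts) => y xs sx /=; constructor; [exact: uP|exact: tsP].
exists (OComp t ts) => x xs sx; apply: oev_comp (tsP _ _ sx) _.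
by apply: tP; rewrite size_map.
Qed.

Lemma cf_app1 a (F : P -> nat -> nat) f :
  cf 1 (fun x xs => F x (nth 0 xs 0)) -> cf a f ->
  cf a (fun x xs => F x (f x xs)).
Proof.
by move=> cF cg; apply: (@cf_comp a _ [:: f] cF) => -[|] //=.
Qed.

Lemma cf_app2 a (F : P -> nat -> nat -> nat) f g :
  cf 2 (fun x xs => F x (nth 0 xs 0) (nth 0 xs 1)) -> cf a f -> cf a g ->
  cf a (fun x xs => F x (f x xs) (g x xs)).
Proof.
by move=> cF c1 c2; apply: (@cf_comp a _ [:: f; g] cF) => -[|[|]] //=.
Qed.

Lemma cf_succ a f : cf a f -> cf a (fun x xs => (f x xs).+1).
Proof.
move=> cF; apply: (@cf_app1 _ (fun _ n => n.+1)) cF.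
by exists OSucc => x [|n [|]] // _; exact: oev_succ.
Qed.

Lemma cf_const a n : cf a (fun _ _ => n).
Proof.
elim: n => [|n IH]; first by exists OZero => *; constructor.
exact: (cf_succ IH).
Qed.

Lemma cf_oracle a f : cf a f -> cf a (fun x xs => o x (f x xs)).
Proof.
move=> cF; apply: (@cf_app1 _ (fun x n => o x n)) cF.
by exists OOracle => x [|n [|]] // _; exact: (@oev_oracle _ [:: n]).
Qed.

(** [ORec] takes its counter from the head of the argument list, so it is composed with [h] followed
    by the [a] projections that reproduce [xs]. *)
Lemma cf_rec a f g h :
  cf a f -> cf a.+2 g -> cf a h ->
  cf a (fun x xs => prec (f x xs) (fun k w => g x [:: k, w & xs]) (h x xs)).
Proof.
move=> [t tP] [u uP] ch.
have cR : cf a.+1 (fun x ys => prec (f x (behead ys))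
    (fun k w => g x [:: k, w & behead ys]) (nth 0 ys 0)).
  exists (ORec t u) => x [|n xs] //= [sx].
  elim: n => [|n IH] /=; first by constructor; exact: tP.
  by apply: oev_recS IH _; apply: uP; rewrite /= sx.
pose gs := h :: [seq (fun (_ : P) ys => nth 0 ys i) | i <- iota 0 a].
have sgs : size gs = a.+1 by rewrite /= size_map size_iota.
rewrite -sgs in cR.
apply: (cf_ext _ (cf_comp cR _)) => [x xs sx|i].
  rewrite /= -map_comp; suff -> : [seq nth 0 xs i | i <- iota 0 a] = xs by [].
  by rewrite -sx map_nth_iota0 // take_size.
rewrite sgs; case: i => [|i] //= ia.
by rewrite (nth_map 0) ?size_iota // nth_iota //; exact: cf_proj.
Qed.

Lemma cf_mu a f g : cf a.+1 g ->
  (forall x xs, size xs = a -> g x (f x xs :: xs) = 0 /\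
     forall m, m < f x xs -> g x (m :: xs) != 0) ->
  cf a f.
Proof.
move=> [t tP] H; exists (OMu t) => x xs sx; have [g0 gm] := H x xs sx.
apply: oev_mu; first by rewrite -g0; apply: tP; rewrite /= sx.
move=> m /gm; rewrite -lt0n => gp; exists (g x (m :: xs)).-1.
by rewrite prednK //; apply: tP; rewrite /= sx.
Qed.

Lemma cf_pred a f : cf a f -> cf a (fun x xs => (f x xs).-1).
Proof.
move=> cF; apply: (cf_ext _ (cf_rec (cf_const a 0) (cf_proj a.+2 0) cF)).
by move=> x xs _ /=; case: (f x xs).
Qed.

Lemma cf_add a f g : cf a f -> cf a g -> cf a (fun x xs => f x xs + g x xs).
Proof.
move=> c1 c2; apply: (cf_ext _ (cf_rec c1 (cf_succ (cf_proj a.+2 1)) c2)).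
by move=> x xs _ /=; elim: (g x xs) => [|n /= ->]; rewrite ?addn0 ?addnS.
Qed.

Lemma cf_sub a f g : cf a f -> cf a g -> cf a (fun x xs => f x xs - g x xs).
Proof.
move=> c1 c2; apply: (cf_ext _ (cf_rec c1 (cf_pred (cf_proj a.+2 1)) c2)).
by move=> x xs _ /=; elim: (g x xs) => [|n /= ->]; rewrite ?subn0 ?subnS.
Qed.

Lemma cf_mul a f g : cf a f -> cf a g -> cf a (fun x xs => f x xs * g x xs).
Proof.
move=> c1 c2.
apply: (@cf_app2 _ (fun _ m n => m * n)) c1 c2.
apply: (cf_ext _ (cf_rec (cf_const 2 0)
  (cf_add (cf_proj 4 1) (cf_proj 4 2)) (cf_proj 2 1))).
by move=> x xs _ /=; elim: (nth 0 xs 1) => [|n /= ->]; rewrite ?muln0 ?mulnS 1?addnC.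
Qed.

Lemma cf_exp2 a f : cf a f -> cf a (fun x xs => 2 ^ (f x xs)).
Proof.
move=> cF; apply: (cf_ext _ (cf_rec (cf_const a 1)
  (cf_mul (cf_const a.+2 2) (cf_proj a.+2 1)) cF)).
by move=> x xs _ /=; elim: (f x xs) => [|n /= ->] //; rewrite expnS.
Qed.

Lemma cf_eq0 a f : cf a f -> cf a (fun x xs => (f x xs == 0) : nat).
Proof.
move=> cF; apply: (cf_ext _ (cf_sub (cf_const a 1) cF)).
by move=> x xs _ /=; case: (f x xs) => // n; rewrite subSS sub0n.
Qed.

Lemma cf_not a (B : P -> seq nat -> bool) : cf a (fun x xs => B x xs : nat) ->
  cf a (fun x xs => ~~ B x xs : nat).
Proof. by move=> /cf_eq0; apply: cf_ext => x xs _; case: (B x xs). Qed.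

Lemma cf_leq a f g : cf a f -> cf a g -> cf a (fun x xs => (f x xs <= g x xs) : nat).
Proof. by move=> c1 c2; exact: cf_eq0 (cf_sub c1 c2). Qed.

Lemma cf_if a (B : P -> seq nat -> bool) f g :
  cf a (fun x xs => B x xs : nat) -> cf a f -> cf a g ->
  cf a (fun x xs => if B x xs then f x xs else g x xs).
Proof.
move=> cB c1 c2.
apply: (cf_ext _ (cf_add (cf_mul cB c1) (cf_mul (cf_not cB) c2))).
by move=> x xs _; case: (B x xs); rewrite /= ?mul1n ?mul0n ?addn0.
Qed.

Lemma cf_odd a f : cf a f -> cf a (fun x xs => odd (f x xs) : nat).
Proof.
move=> cF; apply: (cf_ext _ (cf_rec (cf_const a 0)
  (cf_eq0 (cf_proj a.+2 1)) cF)).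
by move=> x xs _ /=; elim: (f x xs) => [|n /= ->] //; case: odd.
Qed.

Lemma cf_half a f : cf a f -> cf a (fun x xs => (f x xs)./2).
Proof.
move=> cF; apply: (cf_ext _ (cf_rec (cf_const a 0)
  (cf_add (cf_odd (cf_proj a.+2 0)) (cf_proj a.+2 1)) cF)).
by move=> x xs _ /=; elim: (f x xs) => [|n /= ->] //; rewrite uphalf_half.
Qed.

Lemma cf_double a f : cf a f -> cf a (fun x xs => (f x xs).*2).
Proof.
by move=> cF; apply: (cf_ext _ (cf_add cF cF)) => x xs _; rewrite addnn.
Qed.

End UniformlyComputable.

(** * Computability of the coding of finite sequences *)

Local Notation code := CodeSeq.code.
Local Notation decode := CodeSeq.decode.

(** Pairs and sequences are pickled through [code] after pickling their entries, and pickling a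
    number is the identity; inserting [map id] makes both sides convertible. *)
Lemma pickle_nat_seq n (w : seq nat) : pickle (n, w) = code [:: n; code w].
Proof. rewrite -[w in RHS]map_id; reflexivity. Qed.

Lemma iter_half_exp2 m n k : iter m half (2 ^ (m + n) * k) = 2 ^ n * k.
Proof.
elim: m n => [|m IH] n //=.
by rewrite addSnnS IH expnS -mulnA mul2n doubleK.
Qed.

Definition code_tail c := code (behead (decode c)).

Lemma iter_code_tail k c : iter k code_tail c = code (drop k (decode c)).
Proof.
elim: k => [|k /= ->]; first by rewrite drop0 CodeSeq.decodeK.
by rewrite /code_tail CodeSeq.codeK -drop1 drop_drop.
Qed.

Section ComputableCodes.
Variables (P : Type) (o : P -> baire).
Implicit Types (a : nat) (f g : P -> seq nat -> nat).

Lemma cf_iter a (F : nat -> nat) f g :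
  (forall f', cf o a.+2 f' -> cf o a.+2 (fun x xs => F (f' x xs))) ->
  cf o a f -> cf o a g ->
  cf o a (fun x xs => iter (f x xs) F (g x xs)).
Proof.
move=> cF c1 c2; apply: (cf_ext _ (cf_rec c2 (cF _ (cf_proj o a.+2 1)) c1)).
by move=> x xs _ /=; elim: (f x xs) => //= n ->.
Qed.

(** The code of [n :: s] is [2 ^ n * (code s).*2.+1], so the head counts the halvings before an odd
    number appears. The bound in the search stops it at once for code 0, and never too early
    otherwise because [n < 2 ^ n]. *)
Lemma cf_code_head a f : cf o a f ->
  cf o a (fun x xs => head 0 (decode (f x xs))).
Proof.
move=> cF; apply: (@cf_app1 _ _ _ (fun _ c => head 0 (decode c))) cF.
apply: (@cf_mu _ _ _ _ (fun _ ys => ~~ (odd (iter (nth 0 ys 0) half (nth 0 ys 1))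
   || (nth 0 ys 1 <= nth 0 ys 0)))) => [|x [|c []]] //.
  have c1 : cf o 2 (fun _ ys => iter (nth 0 ys 0) half (nth 0 ys 1)).
    by apply: cf_iter (cf_proj _ _ 0) (cf_proj _ _ 1) => ?; exact: cf_half.
  apply/cf_not/(cf_ext _ (cf_if (cf_odd c1) (cf_const _ _ 1)
    (cf_leq (cf_proj _ _ 1) (cf_proj _ _ 0)))) => x ys _.
  by case: (odd _).
move=> _ /=; case: (decode c) (CodeSeq.decodeK c) => [|n s] <- //=.
have -> : iter n half (2 ^ n * (code s).*2.+1) = (code s).*2.+1.
  by rewrite -{2}[n]addn0 iter_half_exp2 mul1n.
rewrite /= odd_double; split=> // m mn.
rewrite -{1}(subnKC (ltnW mn)) iter_half_exp2 oddM oddX.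
rewrite subn_eq0 leqNgt mn /= eqb0 negbK -ltnNge.
have m2n : m < 2 ^ n by apply: ltn_trans mn _; exact: ltn_expl.
by rewrite (leq_trans m2n) // leq_pmulr.
Qed.

Lemma cf_code_tail a f : cf o a f ->
  cf o a (fun x xs => code_tail (f x xs)).
Proof.
move=> cF; apply: (@cf_app1 _ _ _ (fun _ => code_tail)) cF.
have c0 := cf_proj o 1 0.
have c1 : cf o 1 (fun _ xs =>
    iter (head 0 (decode (nth 0 xs 0))) half (nth 0 xs 0)).
  by apply: cf_iter (cf_code_head c0) c0 => ?; exact: cf_half.
apply: (cf_ext _ (cf_half c1)) => x xs _.
move: (nth 0 xs 0) => c; rewrite /code_tail.
case: (decode c) (CodeSeq.decodeK c) => [|n s] <- //=.
by rewrite -{2}[n]addn0 iter_half_exp2 mul1n /= uphalf_double.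
Qed.

Lemma cf_code_nth a f g : cf o a f -> cf o a g ->
  cf o a (fun x xs => nth 0 (decode (f x xs)) (g x xs)).
Proof.
move=> cF cg.
have c1 : cf o a (fun x xs => iter (g x xs) code_tail (f x xs)).
  by apply: cf_iter cg cF => ?; exact: cf_code_tail.
apply: (cf_ext _ (cf_code_head c1)) => x xs _.
by rewrite iter_code_tail CodeSeq.codeK -nth0 nth_drop addn0.
Qed.

(** Only the empty sequence has code 0, so the length is the least number of tails that reaches
    0. *)
Lemma cf_code_size a f : cf o a f ->
  cf o a (fun x xs => size (decode (f x xs))).
Proof.
move=> cF; apply: (@cf_app1 _ _ _ (fun _ c => size (decode c))) cF.
have c1 : cf o 2 (fun _ xs => iter (nth 0 xs 0) code_tail (nth 0 xs 1)).
  by apply: cf_iter (cf_proj _ _ 0) (cf_proj _ _ 1) => ?; exact: cf_code_tail.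
apply: (cf_mu c1) => x xs _ /=; rewrite iter_code_tail drop_size.
split=> // m ms; rewrite iter_code_tail; case E: (drop m _) => [|n s] /=.
  by move/(congr1 size): E; rewrite size_drop => /eqP; rewrite subn_eq0 leqNgt ms.
by rewrite muln_eq0 expn_eq0.
Qed.

Lemma cf_code_cons a f g : cf o a f -> cf o a g ->
  cf o a (fun x xs => 2 ^ f x xs * (g x xs).*2.+1).
Proof.
by move=> c1 c2; exact: (cf_mul (cf_exp2 c1) (cf_succ (cf_double c2))).
Qed.

Lemma cf_code_mkseq a (r : P -> baire) f :
  cf o 1 (fun x xs => r x (nth 0 xs 0)) -> cf o a f ->
  cf o a (fun x xs => code (mkseq (r x) (f x xs))).
Proof.
move=> cr cF; apply: (@cf_app1 _ _ _ (fun x c => code (mkseq (r x) c))) cF.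
apply: (cf_ext _ (cf_rec (cf_const _ 1 0) (cf_code_cons (cf_app1 cr
  (cf_sub (cf_pred (cf_proj _ 3 2)) (cf_proj _ 3 0))) (cf_proj _ 3 1))
  (cf_proj _ _ 0))).
move=> x xs _ /=; move: (nth 0 xs 0) => n.
(* Codes grow at the front, so the sequence is built from its end: after [k] rounds the last [k]
   entries are coded, and [n.-1 - k] is the next index. *)
have H k : k <= n -> prec 0 (fun k w => 2 ^ r x (n.-1 - k) * w.*2.+1) k
    = code [seq r x i | i <- iota (n - k) k].
  elim: k => [|k IH] kn //=; rewrite IH; last exact: ltnW.
  by rewrite -subn1 -subnDA add1n subnSK.
by rewrite H // subnn.
Qed.

End ComputableCodes.

(** * Fuel-bounded evaluation *)

Fixpoint all_prop {T : Type} (Q : T -> Prop) (s : seq T) : Prop :=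
  if s is x :: s' then Q x /\ all_prop Q s' else True.

(** The generated induction principle has no hypothesis for the list of terms in [OComp]; [all_prop]
    supplies it. *)
Lemma oterm_nested_ind (Q : oterm -> Prop) :
  Q OZero -> Q OSucc -> (forall i, Q (OProj i)) -> Q OOracle ->
  (forall f gs, Q f -> all_prop Q gs -> Q (OComp f gs)) ->
  (forall f g, Q f -> Q g -> Q (ORec f g)) ->
  (forall f, Q f -> Q (OMu f)) ->
  forall t, Q t.
Proof.
move=> Qz Qs Qp Qo Qc Qr Qm; fix IH 1; case; [by []|by []|exact: Qp|by []| | |].
- by move=> f gs; apply: Qc; [exact: IH|elim: gs => [|g gs IHgs] /=; split].
- by move=> f g; apply: Qr; exact: IH.
- by move=> f; apply: Qm; exact: IH.
Qed.

(* [0] while still searching, [1] after an undefined value, [n.+2] once [n] is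
   found; [v m] codes "undefined" as [0] and the value [k] as [k.+1]. *)
Definition mu_search (v : nat -> nat) : nat -> nat :=
  prec 0 (fun j acc => if acc != 0 then acc else
    if v j == 0 then 1 else if v j <= 1 then j.+2 else 0).

Lemma mu_searchS v k : mu_search v k.+1 =
  if mu_search v k != 0 then mu_search v k else
  if v k == 0 then 1 else if v k <= 1 then k.+2 else 0.
Proof. by []. Qed.

Lemma mu_search_sound v N n : mu_search v N = n.+2 ->
  v n = 1 /\ forall m, m < n -> 1 < v m.
Proof.
have H0 k : mu_search v k = 0 -> forall m, m < k -> 1 < v m.
  elim: k => // k IH; rewrite mu_searchS.
  case: (mu_search v k) IH => [IH|] //=.
  case vk: (v k) => [|[|w]] //= _ m.
  by rewrite ltnS leq_eqVlt => /orP[/eqP ->|]; [rewrite vk|exact: IH].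
elim: N => // k IH; rewrite mu_searchS.
case: (mu_search v k) IH (H0 k) => [|s] //= _ Hk.
case vk: (v k) => [|[|w]] //= [<-]; split=> // m mk.
exact: Hk.
Qed.

Lemma mu_search_complete v N n : n < N -> v n = 1 ->
  (forall m, m < n -> 1 < v m) -> mu_search v N = n.+2.
Proof.
move=> nN vn vm.
have H0 k : k <= n -> mu_search v k = 0.
  elim: k => // k IH kn; rewrite mu_searchS IH ?(ltnW kn) //=.
  by case: (v k) (vm _ kn) => [|[|]].
elim: N nN => // N IH; rewrite mu_searchS ltnS leq_eqVlt => /orP[/eqP <-|nN].
  by rewrite H0 //= vn.
by rewrite IH.
Qed.

(* Evaluation with fuel [N] and a partial oracle; values and oracle answers are
   shifted by one, [0] meaning "undefined". *)
Fixpoint tev (o : nat -> nat) (N : nat) (t : oterm) (xs : seq nat) : nat :=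
  match t with
  | OZero => 1
  | OSucc => (head 0 xs).+2
  | OProj i => (nth 0 xs i).+1
  | OOracle => o (head 0 xs)
  | OComp f gs =>
      let ys := [seq tev o N g xs | g <- gs] in
      if all (fun y => y != 0) ys then tev o N f [seq y.-1 | y <- ys] else 0
  | ORec f g =>
      if xs is k :: ys then
        prec (tev o N f ys) (fun j acc =>
          if acc == 0 then 0 else tev o N g [:: j, acc.-1 & ys]) k
      else 0
  | OMu f => (mu_search (fun n => tev o N f (n :: xs)) N).-1
  end.

Lemma tev_sound p o N t xs v :
  (forall i w, o i = w.+1 -> p i = w) ->
  tev o N t xs = v.+1 -> oeval p t xs v.
Proof.
move=> po; elim/oterm_nested_ind: t xs v => /=.
- by move=> xs v [<-]; constructor.
- by move=> xs v [<-]; constructor.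
- by move=> i xs v [<-]; constructor.
- by move=> xs v /po <-; constructor.
- move=> f gs IHf IHgs xs v.
  case: ifP => // nz /IHf; apply: oev_comp.
  elim: gs IHgs nz => [|g gs IH] /=; first by constructor.
  move=> [IHg IHgs] /andP[gn0 /(IH IHgs) H]; constructor=> //.
  by apply: IHg; rewrite prednK // lt0n.
- move=> f g IHf IHg [|k xs] v //.
  elim: k v => [|k IH] v /=; first by move=> /IHf; constructor.
  move: IH; set w := prec _ _ _; case: w => [|w] //= IH /IHg.
  exact: (oev_recS (IH _ erefl)).
- move=> f IHf xs v; case E: mu_search => [|[|n]] //= -[<-].
  have [vn vm] := mu_search_sound E; apply: oev_mu; first exact: IHf.
  move=> m /vm; case E': (tev _ _ _ _) => [|[|w]] // _.
  by exists w; exact: IHf.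
Qed.

(** A finite derivation reads finitely many oracle values and makes bounded searches, so one [M]
    serves as fuel and as length of the known oracle prefix. Allowing all larger fuels and longer
    prefixes lets the bounds of subderivations be combined by maxima. *)
Lemma tev_complete p t xs v : oeval p t xs v ->
  exists M, forall N o, M <= N -> (forall i, i < M -> o i = (p i).+1) ->
    tev o N t xs = v.+1.
Proof.
elim/oterm_nested_ind: t xs v => /=.
- by move=> xs v E; inversion E; subst; exists 0.
- by move=> xs v E; inversion E; subst; exists 0.
- by move=> i xs v E; inversion E; subst; exists 0.
- move=> xs v E; inversion E; subst; exists (head 0 xs).+1 => N o _.
  exact.
- move=> f gs IHf IHgs xs v E.
  inversion E as [| | | |? ? ? ys ? Egs Ef| | |]; subst.
  have [M MP] := IHf _ _ Ef.
  have [M' MP'] : exists M, forall N o, M <= N ->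
      (forall i, i < M -> o i = (p i).+1) ->
      [seq tev o N g xs | g <- gs] = [seq y.+1 | y <- ys].
    elim: gs ys IHgs Egs {IHf Ef MP E} => [|g gs IH] ys /=.
      by move=> _ E; inversion E; exists 0.
    move=> [IHg IHgs] E; inversion E as [|? ? ? y ys' Eg Egs]; subst.
    have [M1 MP1] := IHg _ _ Eg; have [M2 MP2] := IH _ IHgs Egs.
    exists (maxn M1 M2) => N o; rewrite geq_max => /andP[l1 l2] oM /=.
    rewrite MP1 ?MP2 // => i iM; apply: oM; rewrite leq_max iM //.
    by rewrite orbT.
  exists (maxn M M') => N o; rewrite geq_max => /andP[l1 l2] oM.
  rewrite MP' // => [|i iM]; last by apply: oM; rewrite leq_max iM orbT.
  have -> : all (fun y => y != 0) [seq y.+1 | y <- ys] by apply/allP => y /mapP[? _ ->].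
  rewrite -map_comp (eq_map (g := id)) // map_id MP // => i iM.
  by apply: oM; rewrite leq_max iM.
- move=> f g IHf IHg [|k xs] v; first by move=> E; inversion E.
  elim: k v => [|k IH] v E.
    inversion E as [| | | | |? ? ? ? Ef| |]; subst.
    exact: IHf.
  inversion E as [| | | | | |? ? ? ? w ? Er Eg|]; subst.
  have [M1 MP1] := IH _ Er; have [M2 MP2] := IHg _ _ Eg.
  exists (maxn M1 M2) => N o; rewrite geq_max => /andP[l1 l2] oM /=.
  rewrite MP1 //= ?MP2 // => i iM; apply: oM; rewrite leq_max iM //.
  by rewrite orbT.
- move=> f IHf xs v E.
  inversion E as [| | | | | | |? ? ? E0 Em]; subst.
  have [M1 MP1] := IHf _ _ E0.
  have [M2 MP2] : exists M, forall N o, M <= N ->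
      (forall i, i < M -> o i = (p i).+1) ->
      forall m, m < v -> 1 < tev o N f (m :: xs).
    elim: v Em {E E0 MP1} => [|n IH] Em; first by exists 0.
    have [m /ltnW /Em //|M MP] := IH.
    have [w /IHf[M' MP']] := Em n (ltnSn n).
    exists (maxn M M') => N o; rewrite geq_max => /andP[l1 l2] oM m.
    rewrite ltnS leq_eqVlt => /orP[/eqP ->|mn].
      rewrite MP' // => i iM; apply: oM; rewrite leq_max iM orbT //.
    by apply: MP => // i iM; apply: oM; rewrite leq_max iM.
  exists (maxn v.+1 (maxn M1 M2)) => N o.
  rewrite !geq_max => /and3P[l0 l1 l2] oM.
  rewrite (@mu_search_complete _ _ v) // => [|m mv].
    by apply: MP1 => // i iM; apply: oM; rewrite !leq_max iM orbT.
  by apply: MP2 => // i iM; apply: oM; rewrite !leq_max iM !orbT.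
Qed.

(** Both values are returned by the bounded evaluator, a function, once the fuel suffices for both
    derivations. *)
Lemma oeval_det p t xs v w : oeval p t xs v -> oeval p t xs w -> v = w.
Proof.
move=> /tev_complete[M MP] /tev_complete[M' MP'].
have := MP (maxn M M') (fun i => (p i).+1).
by rewrite MP' ?leq_max ?leqnn ?orbT // => /(_ isT (fun _ _ => erefl)) [].
Qed.

Section ComputableEvaluation.
Variables (P : Type) (o : P -> baire) (orc : P -> nat -> nat -> nat).
Hypothesis cf_orc : cf o 2 (fun x xs => orc x (nth 0 xs 0) (nth 0 xs 1)).

(** Fuel and oracle index become ordinary arguments in front of those of [t], so that the evaluator
    can be run at computed values of both. *)
Definition tev_at (t : oterm) (x : P) (ys : seq nat) : nat :=
  tev (orc x (nth 0 ys 1)) (nth 0 ys 0) t (drop 2 ys).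

Definition projs i a : seq (P -> seq nat -> nat) :=
  [seq (fun _ ys => nth 0 ys j) | j <- iota i a].

Lemma projsE x ys i a : size ys = i + a ->
  [seq h x ys | h <- projs i a] = drop i ys.
Proof.
move=> sys; rewrite -map_comp map_nth_iota ?sys ?addKn //.
by rewrite take_oversize // size_drop sys addKn.
Qed.

Lemma cf_projs b i a j : j < size (projs i a) ->
  cf o b (nth (fun _ _ => 0) (projs i a) j).
Proof.
by rewrite size_map => js; rewrite (nth_map 0) //; exact: cf_proj.
Qed.

Lemma cf_tev_comp a t n w (gs : seq (P -> seq nat -> nat)) :
  cf o (size gs).+2 (tev_at t) -> cf o a n -> cf o a w ->
  (forall i, i < size gs -> cf o a (nth (fun _ _ => 0) gs i)) ->
  cf o a (fun x ys => tev (orc x (w x ys)) (n x ys) t [seq g x ys | g <- gs]).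
Proof.
move=> ct cn cw cg.
have H := @cf_comp _ o a (tev_at t) [:: n, w & gs] ct.
apply: (cf_ext _ (H _)); first by move=> x ys _; rewrite /tev_at /= drop0.
by case=> [|[|i]] /= isz; [exact: cn|exact: cw|exact: cg].
Qed.

Lemma cf_tev a t : cf o a.+2 (tev_at t).
Proof.
elim/oterm_nested_ind: t a.
- by move=> a; exact: cf_const.
- move=> a; apply: (cf_ext _ (cf_succ (cf_succ (cf_proj o _ 2)))).
  by move=> x [|? [|? [|? ?]]].
- move=> i a; apply: (cf_ext _ (cf_succ (cf_proj o _ i.+2))).
  by move=> x [|? [|? xs]] //= _; rewrite /tev_at /= drop0.
- move=> a; apply: (cf_ext _ (cf_app2 cf_orc (cf_proj o _ 1) (cf_proj o _ 2))).
  by move=> x [|? [|? [|? ?]]].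
- move=> f gs IHf IHgs a.
  have cnz : cf o a.+2 (fun x ys => all (fun y => y != 0)
      [seq tev_at g x ys | g <- gs] : nat).
    elim: gs IHgs => [|g gs IH] /=; first by move=> _; exact: cf_const.
    move=> [IHg /IH cgs]; have cg := cf_not (cf_eq0 (IHg a)).
    apply: (cf_ext _ (cf_mul cg cgs)) => x ys _.
    by case: (tev_at g x ys != 0); rewrite ?mul1n ?mul0n.
  have cf' : cf o a.+2 (fun x ys => tev (orc x (nth 0 ys 1)) (nth 0 ys 0) f
      [seq h x ys | h <- [seq (fun x ys => (tev_at g x ys).-1) | g <- gs]]).
    apply: cf_tev_comp; [exact: IHf|exact: cf_proj|exact: cf_proj|].
    elim: gs IHgs {cnz} => //= g gs IH [IHg /IH IHgs] [|i] /=.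
      by move=> _; exact/cf_pred/IHg.
    exact: IHgs.
  apply: (cf_ext _ (cf_if cnz cf' (cf_const _ _ 0))) => x ys _.
  by rewrite /tev_at /= -!map_comp.
- move=> f g IHf IHg [|a].
    by apply: (cf_ext _ (cf_const _ _ 0)) => x [|? [|? []]].
  have cb : cf o a.+3 (fun x ys => tev (orc x (nth 0 ys 1)) (nth 0 ys 0) f
      [seq h x ys | h <- projs 3 a]).
    apply: cf_tev_comp; rewrite ?size_map ?size_iota //; try exact: cf_proj.
    by move=> i ia; apply: cf_projs; rewrite size_map size_iota.
  (* Inside the recursion the counter and the accumulator stand in front: fuel and oracle index move
     to positions 2 and 3, and the parameters behind the recursion argument start at 5. The
     accumulator is a shifted value, hence the predecessor. *)
  pose gs : seq (P -> seq nat -> nat) := [:: fun _ ys => nth 0 ys 0,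
    fun _ ys => (nth 0 ys 1).-1 & projs 5 a].
  have cs : cf o a.+4.+1 (fun x ys => tev (orc x (nth 0 ys 3)) (nth 0 ys 2) g
      [seq h x ys | h <- gs]).
    apply: cf_tev_comp; rewrite /= ?size_map ?size_iota //; try exact: cf_proj.
    case=> [_|[_|i]] /=; [exact: cf_proj|exact/cf_pred/cf_proj|].
    by rewrite !ltnS => ia; apply: cf_projs; rewrite size_map size_iota.
  apply: (cf_ext _ (cf_rec cb (cf_if (cf_eq0 (cf_proj o _ 1)) (cf_const _ _ 0)
    cs) (cf_proj o _ 2))) => x [|N [|w [|k zs]]] //= [] sz.
  rewrite /tev_at /= projsE /= ?sz // drop0.
  by apply: eq_prec => j acc; rewrite projsE /= ?sz // drop0.
- move=> f IHf a.
  pose gs : seq (P -> seq nat -> nat) := (fun _ ys => nth 0 ys 0) :: projs 4 a.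
  have cv : cf o a.+4 (fun x ys => tev (orc x (nth 0 ys 3)) (nth 0 ys 2) f
      [seq h x ys | h <- gs]).
    apply: cf_tev_comp; rewrite /= ?size_map ?size_iota //; try exact: cf_proj.
    case=> [|i] /=; first by move=> _; exact: cf_proj.
    by rewrite !ltnS => ia; apply: cf_projs; rewrite size_map size_iota.
  have c1 := cf_proj o a.+4 1.
  apply: (cf_ext _ (cf_pred (cf_rec (cf_const _ _ 0) (cf_if (cf_not (cf_eq0 c1))
    c1 (cf_if (cf_eq0 cv) (cf_const _ _ 1) (cf_if (cf_leq cv (cf_const _ _ 1))
    (cf_succ (cf_succ (cf_proj o _ 0))) (cf_const _ _ 0)))) (cf_proj o _ 0))))
    => x [|N [|w zs]] //= [] sz.
  rewrite /tev_at /= drop0; congr _.-1; apply: eq_prec => j acc.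
  by rewrite projsE /= ?sz // drop0.
Qed.

End ComputableEvaluation.

(** * Names of composites *)

Fixpoint osubst (u t : oterm) : oterm :=
  match t with
  | OOracle => OComp u [:: OProj 0]
  | OComp f gs => OComp (osubst u f) [seq osubst u g | g <- gs]
  | ORec f g => ORec (osubst u f) (osubst u g)
  | OMu f => OMu (osubst u f)
  | _ => t
  end.

Lemma oeval_osubst (p q : nat -> nat) u t xs v :
  (forall n, oeval p u [:: n] (q n)) ->
  oeval q t xs v -> oeval p (osubst u t) xs v.
Proof.
move=> uq; elim/oterm_nested_ind: t xs v => /=.
- by move=> xs v E; inversion E; subst; constructor.
- by move=> xs v E; inversion E; subst; constructor.
- by move=> i xs v E; inversion E; subst; constructor.
- move=> xs v E; inversion E; subst; apply: oev_comp (uq _).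
  by rewrite -nth0; do 2!constructor.
- move=> f gs IHf IHgs xs v E.
  inversion E as [| | | |? ? ? ys ? Egs Ef| | |]; subst.
  apply: oev_comp (IHf _ _ Ef).
  elim: gs ys IHgs Egs {IHf Ef E} => [|g gs IH] ys /=.
    by move=> _ E; inversion E; constructor.
  move=> [IHg IHgs] E; inversion E as [|? ? ? y ys' Eg Egs]; subst.
  by constructor; [exact: IHg|exact: IH].
- move=> f g IHf IHg [|k xs] v; first by move=> E; inversion E.
  elim: k v => [|k IH] v E.
    by inversion E as [| | | | |? ? ? ? Ef| |]; subst; constructor; exact: IHf.
  inversion E as [| | | | | |? ? ? ? w ? Er Eg|]; subst.
  exact: oev_recS (IH _ Er) (IHg _ _ Eg).
- move=> f IHf xs v E.
  inversion E as [| | | | | | |? ? ? E0 Em]; subst.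
  apply: oev_mu; first exact: IHf.
  by move=> m /Em[w Ew]; exists w; exact: IHf.
Qed.

(** * Points of Baire space computed uniformly from a parameter *)

Section ComputablePoints.
Variables (P : Type).
Implicit Types (o p q r e : P -> baire).

Definition cfo o q : Prop := cf o 1 (fun x xs => q x (nth 0 xs 0)).

Lemma cf_trans o q a f : cfo o q -> cf q a f -> cf o a f.
Proof.
move=> [u uP] [t tP]; exists (osubst u t) => x xs sx.
by apply: oeval_osubst (tP x xs sx) => n; exact: uP.
Qed.

Lemma cfo_refl o : cfo o o.
Proof. exact/cf_oracle/cf_proj. Qed.

Lemma cfo_computable (F : pfun) o q r : computable F -> cfo o q ->
  (forall x, F (q x) = Some (r x)) -> cfo o r.
Proof.
move=> [t tP] cq Fr; apply: (cf_trans cq); exists t => x [|n []] // _.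
exact: tP.
Qed.

Lemma cfo_bfst o q : cfo o q -> cfo o (fun x => bfst (q x)).
Proof. by move=> cq; exact: cf_app1 cq (cf_double (cf_proj _ _ 0)). Qed.

Lemma cfo_bsnd o q : cfo o q -> cfo o (fun x => bsnd (q x)).
Proof. by move=> cq; exact: cf_app1 cq (cf_succ (cf_double (cf_proj _ _ 0))). Qed.

Lemma cfo_bpair o p q : cfo o p -> cfo o q -> cfo o (fun x => bpair (p x) (q x)).
Proof.
move=> cp cq; have ch := cf_half (cf_proj o 1 0).
exact: cf_if (cf_odd (cf_proj o 1 0)) (cf_app1 cq ch) (cf_app1 cp ch).
Qed.

Lemma cf_eta_code o e r a f g : cfo o e -> cfo o r -> cf o a f -> cf o a g ->
  cf o a (fun x xs => e x (pickle (f x xs, mkseq (r x) (g x xs)))).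
Proof.
move=> ce cr c1 c2; apply: (cf_app1 ce).
apply: (cf_ext _ (cf_code_cons c1 (cf_code_cons (cf_code_mkseq cr c2)
  (cf_const o a 0)))) => x xs _.
by rewrite pickle_nat_seq.
Qed.

(** A search finds the first prefix of [r x] on which [e x] gives a nonzero answer; the predecessor
    undoes the shift. *)
Lemma cfo_eta o e r q : cfo o e -> cfo o r ->
  (forall x, eta (e x) (r x) (q x)) -> cfo o q.
Proof.
move=> ce cr eq.
pose m x n : nat := sval (cid (eq x n)).
have cm : cf o 1 (fun x xs => m x (nth 0 xs 0)).
  apply: (@cf_mu _ _ _ _ (fun x ys =>
    e x (pickle (nth 0 ys 1, mkseq (r x) (nth 0 ys 0))) == 0)).
    exact/cf_eq0/cf_eta_code/cf_proj/cf_proj.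
  move=> x [|n []] //= _; rewrite /m; case: cid => /= k [-> k0]; split=> // j jk.
  by rewrite k0.
apply: (cf_ext _ (cf_pred (cf_eta_code ce cr (cf_proj o 1 0) cm))).
by move=> x [|n []] //= _; rewrite /m; case: cid => /= k [->].
Qed.

(** Rejection, that is a Sierpinski name with a nonzero entry, becomes halting of one program
    without arguments: the search for such an entry. *)
Lemma nonzero_halting o q : cfo o q -> exists t, forall x,
  (exists v, oeval (o x) t [::] v) <-> (exists n, q x n <> 0).
Proof.
move=> /cf_eq0 [u uP]; exists (OMu u) => x; split=> [[v E]|].
  inversion E as [| | | | | | |? ? n E0 Em]; subst; exists v => qv.
  by have := oeval_det E0 (uP x [:: v] erefl); rewrite /= qv.
move=> [n /eqP qn].
have /ex_minnP[m qm mP] : exists n, q x n != 0 by exists n.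
exists m; apply: oev_mu => [|k km].
  by have := uP x [:: m] erefl; rewrite /= (negbTE qm).
exists 0; have := uP x [:: k] erefl => /=; case: eqP => // /eqP /mP.
by rewrite leqNgt km.
Qed.

End ComputablePoints.

(** The graph of [F] is the parameter type, so definedness of [F] is part of each parameter. *)
Lemma computable_cfo (F : pfun) :
  cfo (fun x : {pq | F pq.1 = Some pq.2} => (sval x).1)
      (fun x => (sval x).2) -> computable F.
Proof.
by move=> [t tP]; exists t => p q Fpq n; exact: (tP (exist _ (p, q) Fpq) [:: n]).
Qed.

Lemma bfst_bpair p q : bfst (bpair p q) = p.
Proof. by apply/funext => n; rewrite /bfst /bpair odd_double doubleK. Qed.

Lemma bsnd_bpair p q : bsnd (bpair p q) = q.
Proof. by apply/funext => n; rewrite /bsnd /bpair /= odd_double /= uphalf_double. Qed.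

Lemma bpair_eta p : bpair (bfst p) (bsnd p) = p.
Proof.
apply/funext => n; rewrite /bfst /bpair /bsnd -[in RHS](odd_double_half n).
by case: odd.
Qed.

(** * Dovetailing two halting tests *)

Section DovetailedTest.
Variables t1 t2 : oterm.

(* Oracle [bpair p r] with [r] known only on the prefix coded by [wc]. *)
Definition prefix_oracle (p : baire) (wc x : nat) : nat :=
  if odd x then
    (if x./2 < size (decode wc) then (nth 0 (decode wc) x./2).+1 else 0)
  else (p x./2).+1.

(** The length of the prefix is also the fuel, so longer prefixes give both tests more time and
    neither can block the other. *)
Definition stage (p : baire) (wc : nat) : bool :=
  let run t := tev (prefix_oracle p wc) (size (decode wc)) t [::] in
  (run t1 != 0) || (run t2 != 0).

(** In the sense of [eta] it stays silent on prefixes shorter than the queried index, so the first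
    answer, shifted by one, comes at length exactly that index. *)
Definition stage_name (p : baire) : baire := fun c =>
  let wc := nth 0 (decode c) 1 in
  if nth 0 (decode c) 0 <= size (decode wc) then (stage p wc).+1 else 0.

Lemma cf_prefix_oracle : cf id 2
  (fun p xs => prefix_oracle p (nth 0 xs 0) (nth 0 xs 1)).
Proof.
have c0 := cf_proj (id : baire -> baire) 2 0.
have c1 := cf_proj (id : baire -> baire) 2 1.
have ch := cf_half c1.
exact: cf_if (cf_odd c1) (cf_if (cf_leq (cf_succ ch) (cf_code_size c0))
  (cf_succ (cf_code_nth c0 ch)) (cf_const _ _ 0)) (cf_succ (cf_oracle ch)).
Qed.

Lemma cf_stage a f : cf id a f -> cf id a (fun p xs => stage p (f p xs) : nat).
Proof.
move=> cF; apply: (cf_app1 (F := fun p c => nat_of_bool (stage p c))) cF.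
have c0 := cf_proj (id : baire -> baire) 1 0.
have crun t : cf id 1 (fun p xs => tev (prefix_oracle p (nth 0 xs 0))
    (size (decode (nth 0 xs 0))) t [::]).
  exact: (@cf_tev_comp _ _ _ 1 t _ _ [::] (cf_tev cf_prefix_oracle 0 t)
    (cf_code_size c0) c0).
apply: (cf_ext _ (cf_if (cf_not (cf_eq0 (crun t1))) (cf_const _ _ 1)
  (cf_not (cf_eq0 (crun t2))))) => p xs _.
by rewrite /stage; case: (tev _ _ t1 _ != 0).
Qed.

Lemma computable_stage_name : computable (fun p => Some (stage_name p)).
Proof.
have [t tP] : cf (id : baire -> baire) 1 (fun p xs => stage_name p (nth 0 xs 0)).
  have cn i := cf_code_nth (cf_proj (id : baire -> baire) 1 0) (cf_const _ _ i).
  exact: cf_if (cf_leq (cn 0) (cf_code_size (cn 1)))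
    (cf_succ (cf_stage (cn 1))) (cf_const _ _ 0).
by exists t => p q [<-] n; exact: (tP p [:: n]).
Qed.

Lemma eta_stage_name p r :
  eta (stage_name p) r (fun n => stage p (code (mkseq r n)) : nat).
Proof.
move=> n; exists n; rewrite pickle_nat_seq /stage_name !CodeSeq.codeK /=.
rewrite ?CodeSeq.codeK size_mkseq leqnn; split=> // m mn.
by rewrite pickle_nat_seq !CodeSeq.codeK /= ?CodeSeq.codeK size_mkseq leqNgt mn.
Qed.

(** One direction is soundness of bounded evaluation. Conversely, a halting run reads finitely many
    oracle positions, and an odd position [i < n] asks for the entry [i./2] of [r], which a prefix
    of length [n] contains. *)
Lemma stage_halting p r :
  (exists n, stage p (code (mkseq r n))) <->
  (exists v, oeval (bpair p r) t1 [::] v) \/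
  (exists v, oeval (bpair p r) t2 [::] v).
Proof.
have oP n i w : prefix_oracle p (code (mkseq r n)) i = w.+1 -> bpair p r i = w.
  rewrite /prefix_oracle /bpair CodeSeq.codeK size_mkseq.
  case: odd => [|[//]]; case: ifP => // /(nth_mkseq 0 r) ->.
  by case.
have oM n i : i < n -> prefix_oracle p (code (mkseq r n)) i = (bpair p r i).+1.
  move=> i_n; rewrite /prefix_oracle /bpair CodeSeq.codeK size_mkseq.
  have hn : i./2 < n.
    by apply: leq_ltn_trans i_n; rewrite leq_half_double -addnn -addnS leq_addr.
  by case: odd; rewrite // hn nth_mkseq.
have sound t n : tev (prefix_oracle p (code (mkseq r n))) n t [::] != 0 ->
    exists v, oeval (bpair p r) t [::] v.
  case E: tev => [|v] // _; exists v; exact: tev_sound (@oP n) E.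
have complete t v : oeval (bpair p r) t [::] v ->
    exists n, tev (prefix_oracle p (code (mkseq r n))) n t [::] != 0.
  by move=> /tev_complete[M MP]; exists M; rewrite (MP M) // => i; exact: oM.
rewrite /stage; split=> [[n]|].
  by rewrite CodeSeq.codeK size_mkseq => /orP[/sound|/sound]; [left|right].
by case=> -[v /complete[n H]]; exists n;
  rewrite CodeSeq.codeK size_mkseq H ?orbT.
Qed.

End DovetailedTest.

(* Composes the choice set named by [K2 p] with the choice sets named by
   [K1 (H2 (p, s))]: [b p] detects, on prefixes of [(r, s)], that [s] is rejected
   by the former or [r] by the latter.  If [s] is rejected, [K1 (H2 (p, s))] need
   not be defined. *)
Lemma composite_name (K2 H2 K1 : pfun) :
  computable K2 -> computable H2 -> computable K1 ->
  exists (k : baire -> baire) (b : baire -> seq nat -> bool),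
  [/\ computable (fun p => Some (k p)),
      forall p r, eta (k p) r (fun n => b p (mkseq r n) : nat),
      forall p r e q, K2 p = Some e -> eta e (bsnd r) q ->
        (exists n, q n <> 0) -> exists n, b p (mkseq r n) &
      forall p r e q y e' q', K2 p = Some e -> eta e (bsnd r) q ->
        H2 (bpair p (bsnd r)) = Some y -> K1 y = Some e' ->
        eta e' (bfst r) q' -> (exists n, b p (mkseq r n)) ->
        (exists n, q n <> 0) \/ (exists n, q' n <> 0)] /\
      (forall p r y e' q', H2 (bpair p (bsnd r)) = Some y -> K1 y = Some e' ->
        eta e' (bfst r) q' -> (exists n, q' n <> 0) ->
        exists n, b p (mkseq r n)).
Proof.
move=> cK2 cH2 cK1.
(* On [P1] the partial maps [K2] and [eta] are defined, so the verdict [q] on the second component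
   [bsnd r] is uniformly computable from [bpair p r]. *)
pose P1 := {x : baire * baire * baire * baire |
  let: (p, r, e, q) := x in K2 p = Some e /\ eta e (bsnd r) q}.
pose o1 (x : P1) := let: (p, r, e, q) := sval x in bpair p r.
have [t1 t1P] : exists t, forall p r e q, K2 p = Some e -> eta e (bsnd r) q ->
    ((exists v, oeval (bpair p r) t [::] v) <-> exists n, q n <> 0).
  have cp := cfo_bfst (cfo_refl o1).
  have cs := cfo_bsnd (cfo_bsnd (cfo_refl o1)).
  have ce : cfo o1 (fun x => (sval x).1.2).
    apply: (cfo_computable cK2 cp) => -[[[[p r] e] q] H].
    by rewrite /o1 /= bfst_bpair; case: H.
  have cq : cfo o1 (fun x => (sval x).2).
    apply: (cfo_eta ce cs) => -[[[[p r] e] q] H].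
    by rewrite /o1 /= bsnd_bpair; case: H.
  have [t tP] := nonzero_halting cq; exists t => p r e q h1 h2.
  exact: (tP (exist _ (p, r, e, q) (conj h1 h2))).
(* The same for the second test, where [e] names the set against which the first component [bfst r]
   is tested. *)
pose P2 := {x : baire * baire * baire * baire * baire |
  let: (p, r, y, e, q) := x in
  [/\ H2 (bpair p (bsnd r)) = Some y, K1 y = Some e & eta e (bfst r) q]}.
pose o2 (x : P2) := let: (p, r, y, e, q) := sval x in bpair p r.
have [t2 t2P] : exists t, forall p r y e q, H2 (bpair p (bsnd r)) = Some y ->
    K1 y = Some e -> eta e (bfst r) q ->
    ((exists v, oeval (bpair p r) t [::] v) <-> exists n, q n <> 0).
  have cp := cfo_bfst (cfo_refl o2).
  have cr := cfo_bsnd (cfo_refl o2).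
  have cy : cfo o2 (fun x => (sval x).1.1.2).
    apply: (cfo_computable cH2 (cfo_bpair cp (cfo_bsnd cr))).
    move=> [[[[[p r] y] e] q] H].
    by rewrite /o2 /= bfst_bpair bsnd_bpair; case: H.
  have ce : cfo o2 (fun x => (sval x).1.2).
    by apply: (cfo_computable cK1 cy) => -[[[[[p r] y] e] q] H] /=; case: H.
  have cq : cfo o2 (fun x => (sval x).2).
    apply: (cfo_eta ce (cfo_bfst cr)) => -[[[[[p r] y] e] q] H].
    by rewrite /o2 /= bsnd_bpair; case: H.
  have [t tP] := nonzero_halting cq; exists t => p r y e q h1 h2 h3.
  exact: (tP (exist _ (p, r, y, e, q) (And3 h1 h2 h3))).
exists (stage_name t1 t2), (fun p w => stage t1 t2 p (code w)).
split; first split.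
- exact: computable_stage_name.
- exact: eta_stage_name.
- move=> p r e q Ke eq qn; apply/stage_halting; left.
  exact/(t1P _ _ _ _ Ke eq).
- move=> p r e q y e' q' Ke eq Hy Ke' eq' /stage_halting [].
    by move=> /(t1P _ _ _ _ Ke eq); left.
  by move=> /(t2P _ _ _ _ _ Hy Ke' eq'); right.
- move=> p r y e' q' Hy Ke' eq' qn; apply/stage_halting; right.
  exact/(t2P _ _ _ _ _ Hy Ke' eq').
Qed.

(** This is the outer map of the final reduction: from the input and a name of [(r, s)] the
    intermediate point is recomputed through [H2] and passed with [r] to [H1]. *)
Lemma computable_composite_output (H1 H2 : pfun) :
  computable H1 -> computable H2 ->
  computable (fun w => obind (fun y => H1 (bpair y (bfst (bsnd w))))
                             (H2 (bpair (bfst w) (bsnd (bsnd w))))).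
Proof.
move=> cH1 cH2; set F := (F in computable F); apply: computable_cfo.
pose o (x : {pq | F pq.1 = Some pq.2}) := (sval x).1.
have cw := cfo_refl o.
(* The zero default is never reached, since [F] is defined on the input carried by each
   parameter. *)
pose y (x : {pq | F pq.1 = Some pq.2}) : baire :=
  odflt (fun=> 0) (H2 (bpair (bfst (o x)) (bsnd (bsnd (o x))))).
have cy : cfo o y.
  apply: (cfo_computable cH2 (cfo_bpair (cfo_bfst cw) (cfo_bsnd (cfo_bsnd cw)))).
  by move=> [[w z] Fw]; move: (Fw); rewrite /y /F /o /=; case: (H2 _).
apply: (cfo_computable cH1 (cfo_bpair cy (cfo_bfst (cfo_bsnd cw)))).
by move=> [[w z] Fw]; move: (Fw); rewrite /y /F /o /=; case: (H2 _).
Qed.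

Local Open Scope classical_set_scope.
Local Open Scope ring_scope.

(** * The mean value property *)

Section MeanValue.
Variables (K : realType) (d : measure_display) (T : measurableType d).
Variable mu : {measure set T -> \bar K}.
Implicit Types (A B : set T) (f g : T -> \bar K) (I J : xinterval K).
Local Open Scope ereal_scope.

(** A nonnegative function with zero integral vanishes almost everywhere; as [g] is positive on [B],
    this would make [B] null. *)
Lemma integral_gt0 B g : measurable B -> measurable_fun B g ->
  (forall x, B x -> 0 < g x) -> 0 < mu B -> 0 < \int[mu]_(x in B) g x.
Proof.
move=> mB mg g0 B0; have g0' x : B x -> 0 <= g x by move=> /g0/ltW.
rewrite lt_neqAle integral_ge0 // andbT; apply/eqP => /esym int0.
have /(ae_eq_integral_abs mu mB mg) [N [mN N0 sN]] :
    \int[mu]_(x in B) `|g x| = 0.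
  by rewrite -int0; apply: eq_integral => x /set_mem /g0' /gee0_abs.
suff : mu B = 0 by move=> B0'; rewrite B0' ltxx in B0.
apply: (subset_measure0 mB mN _ N0) => x Bx; apply: sN => /= /(_ Bx) gx0.
by have := g0 x Bx; rewrite gx0 ltxx.
Qed.

(** [f < g] makes [f] finite, so [g] is [f] plus the positive [g - f]; adding a positive integral is
    strict because that of [f] is finite. *)
Lemma integral_lt B f g : measurable B -> measurable_fun B f ->
  measurable_fun B g -> (forall x, B x -> 0 <= f x) ->
  (forall x, B x -> f x < g x) -> 0 < mu B -> \int[mu]_(x in B) f x < +oo ->
  \int[mu]_(x in B) f x < \int[mu]_(x in B) g x.
Proof.
move=> mB mf mg f0 fg B0 intf.
have ffin x : B x -> f x \is a fin_num.
  by move=> Bx; rewrite ge0_fin_numE ?f0 // (lt_le_trans (fg x Bx)) ?leey.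
have gf0 x : B x -> 0 < g x - f x by move=> Bx; rewrite sube_gt0 fg.
have -> : \int[mu]_(x in B) g x =
    \int[mu]_(x in B) f x + \int[mu]_(x in B) (g x - f x).
  rewrite -ge0_integralD //; last 2 first.
  - by move=> x /gf0 /ltW.
  - exact: emeasurable_funB.
  by apply: eq_integral => x /set_mem Bx; rewrite addeC subeK ?ffin.
rewrite lteDl; first by apply: integral_gt0 => //; exact: emeasurable_funB.
by rewrite ge0_fin_numE // integral_ge0.
Qed.

Lemma in_intervalE I : in_interval I = [set` Interval
  (BSide (ilo_closed I) (ilo I)%:E)
  (BSide (~~ ihi_closed I) (if ihi I is Some b then b%:E else +oo))].
Proof.
apply/funext => x; apply/propext; rewrite /in_interval /=.
rewrite itv_boundlr /= /Order.le /=.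
case: (ilo_closed I); case: (ihi_closed I) => /=;
  by split => [[? ?]|/andP[? ?]]; [apply/andP; split|split].
Qed.

Lemma measurable_in_interval I : measurable (in_interval I : set (\bar K)).
Proof. by rewrite in_intervalE; exact: emeasurable_itv. Qed.

(** The witness [c] is the average of [f] over [B]; open endpoints are handled by strict
    monotonicity of the integral. *)
Lemma integral_in_interval_gt0 I B f : measurable B -> measurable_fun B f ->
  (forall x, B x -> 0 <= f x) -> (forall x, B x -> in_interval I (f x)) ->
  0 < mu B -> mu B < +oo -> ~ infty_open I ->
  exists2 c, in_interval I c & \int[mu]_(x in B) f x = c * mu B.
Proof.
move=> mB mf f0 fI B0 Boo nI.
have Bfin : mu B \is a fin_num by rewrite ge0_fin_numE.
set m := fine (mu B); have mE : mu B = m%:E by rewrite /m fineK.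
have m0 : (0 < m)%R by rewrite -lte_fin -mE.
have mc (c : \bar K) : measurable_fun B (cst c) by exact: measurable_cst.
have int_ge0 : 0 <= \int[mu]_(x in B) f x by exact: integral_ge0.
(* An infinite integral over a set of finite measure excludes a real right endpoint, so [+oo] is a
   closed endpoint of [I]. *)
have [oo|intoo] := eqVneq (\int[mu]_(x in B) f x) +oo.
  exists +oo; last by rewrite oo mE gt0_mulye.
  have [hiI|[b hiI]] : ihi I = None \/ exists b, ihi I = Some b.
    by case: (ihi I) => [b|]; [right; exists b|left].
    rewrite /in_interval hiI; case hc: (ihi_closed I); last by case: nI.
    by split; [case: ifP => _; rewrite ?leey ?ltry|rewrite lexx].
  have fb x : B x -> f x <= b%:E.
    move=> /fI [_]; rewrite hiI /=; case: ifP => // _; exact: ltW.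
  have : \int[mu]_(x in B) f x <= \int[mu]_(x in B) (cst b%:E) x.
    exact: ge0_le_integral.
  by rewrite oo integral_cst // mE -EFinM leye_eq.
have intfin : \int[mu]_(x in B) f x \is a fin_num.
  by rewrite ge0_fin_numE // lt_neqAle intoo leey.
set z := fine (\int[mu]_(x in B) f x).
have zE : \int[mu]_(x in B) f x = z%:E by rewrite /z fineK.
have z0 : (0 <= z)%R by rewrite -lee_fin -zE.
exists (z / m)%:E; last by rewrite zE mE -EFinM divfK // gt_eqF.
split; last first.
  case hiI: (ihi I) => [b|] /=; last first.
    by case: ifP => _; rewrite ?leey ?ltry.
  have fb x : B x -> if ihi_closed I then f x <= b%:E else f x < b%:E.
    by move=> /fI [_]; rewrite hiI.
  case: ifP fb => _ fb.
    rewrite lee_fin ler_pdivrMr // -lee_fin EFinM -zE -mE -integral_cst //.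
    exact: ge0_le_integral.
  rewrite lte_fin ltr_pdivrMr // -lte_fin EFinM -zE -mE -integral_cst //.
  by apply: integral_lt => //; rewrite zE ltry.
(* A negative left endpoint lies below the nonnegative average; a nonnegative one is integrated as a
   constant function. *)
have [lo0|lo0] := ltP (ilo I) 0%R.
  have lozm : (ilo I < z / m)%R.
    by apply: (lt_le_trans lo0); rewrite divr_ge0 // ltW.
  by case: ifP => _; rewrite ?lee_fin ?lte_fin // ltW.
have flo x : B x -> if ilo_closed I then (ilo I)%:E <= f x else (ilo I)%:E < f x.
  by move=> /fI [].
case: ifP flo => _ flo.
  rewrite lee_fin ler_pdivlMr // -lee_fin EFinM -zE -mE -integral_cst //.
  by apply: ge0_le_integral.
rewrite lte_fin ltr_pdivlMr // -lte_fin EFinM -zE -mE -integral_cst //.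
apply: integral_lt => //.
  by rewrite integral_cst // mE -EFinM ltry.
Qed.

Lemma integral_in_interval_infty I J B f : measurable B ->
  measurable_fun B f -> (forall x, B x -> 0 <= f x) ->
  (forall x, B x -> in_interval I (f x)) -> mu B = +oo ->
  in_interval J +oo -> in_interval_prod I J (\int[mu]_(x in B) f x).
Proof.
move=> mB mf f0 fI Boo Joo.
have B0 : 0 < mu B by rewrite Boo ltry.
set z := \int[mu]_(x in B) f x.
have z_ge0 : 0 <= z by exact: integral_ge0.
have exB (Q : set T) : (forall x, B x -> ~ Q x -> 0 < f x) -> z = 0 ->
    exists2 x, B x & Q x.
  move=> Qf z0; apply: contrapT => nQ.
  suff : 0 < z by rewrite z0 ltxx.
  by apply: integral_gt0 => // x Bx; apply: Qf => // Qx; apply: nQ; exists x.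
(* A zero integral over a set of positive measure forces a zero of [f], so 0 is in [I] and
   [0 * +oo = 0]. *)
have [z0|z0] := eqVneq z 0.
  have [x Bx fx0] : exists2 x, B x & f x = 0.
    apply: exB => // x Bx /eqP fx; rewrite lt_neqAle eq_sym fx /=.
    exact: f0.
  by exists 0, +oo; rewrite mul0e; split; [rewrite -fx0; exact: fI|].
have z_gt0 : 0 < z by rewrite lt_neqAle eq_sym z0.
have [x Bx fx0] : exists2 x, B x & 0 < f x.
  apply: contrapT => nf; move/negP: z0; apply; apply/eqP.
  rewrite /z (eq_integral (cst 0)) ?integral0 // => x /set_mem Bx.
  apply/eqP; rewrite eq_le f0 // andbT leNgt; apply/negP => fx.
  by apply: nf; exists x.
have [zoo|zoo] := eqVneq z +oo.
  exists (f x), +oo; rewrite zoo; split; first exact: fI.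
  by split=> //; rewrite gt0_muley.
have zfin : z \is a fin_num by rewrite ge0_fin_numE // lt_neqAle zoo leey.
(* A positive left endpoint would bound the integral below by a positive multiple of [+oo]. *)
have [lo0|lo0] := ltP 0%R (ilo I).
  have : (ilo I)%:E * mu B <= z.
    rewrite -integral_cst //; apply: ge0_le_integral => //.
    - by move=> ? _ /=; rewrite lee_fin ltW.
    - by move=> y /fI []; case: ifP => // _ /ltW.
  by rewrite Boo gt0_muley ?lte_fin // leye_eq => /eqP zoo'; rewrite zoo' eqxx in zoo.
(* Now [I] contains all small positive reals and [J] all large ones. *)
have [c c0 cI] : exists2 c : K, (0 < c)%R & c%:E <= f x.
  have [fxoo|fxoo] := eqVneq (f x) +oo; first by exists 1%R => //; rewrite fxoo leey.
  have fxfin : f x \is a fin_num by rewrite ge0_fin_numE ?f0 // lt_neqAle fxoo leey.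
  by exists (fine (f x)); [rewrite -lte_fin fineK|rewrite fineK].
(* Since [+oo] is in [J], every real above [ilo J] is in [J]. Taking [w] above [fine z / c] as well
   puts [fine z / w] below [c], hence below a value of [f]. *)
have [w wJ0 wJ] : exists2 w : K, (fine z / c < w)%R & in_interval J w%:E.
  have [Jl Jh] := Joo.
  exists (Num.max (fine z / c) (ilo J) + 1)%R.
    by rewrite ltr_pwDr // le_max lexx.
  split.
    have : (ilo J < Num.max (fine z / c) (ilo J) + 1)%R.
      by rewrite ltr_pwDr // le_max lexx orbT.
    by case: ifP => _; rewrite ?lee_fin ?lte_fin // => /ltW.
  by move: Jh; case: (ihi J) => [b|] /=; case: ifP => _ //; rewrite ?leey ?ltry.
have fz0 : (0 < fine z)%R by rewrite -lte_fin fineK.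
have w0 : (0 < w)%R by apply: lt_trans wJ0; rewrite divr_gt0.
exists (fine z / w)%:E, w%:E; split; last first.
  by split=> //; rewrite -EFinM divfK ?fineK // gt_eqF.
have zw0 : (0 < fine z / w)%R by rewrite divr_gt0.
split.
  by case: ifP => _; rewrite ?lee_fin ?lte_fin ?(le_lt_trans lo0) //
    (le_trans lo0) // ltW.
have zc : (fine z / w)%:E <= f x.
  apply: le_trans cI; rewrite lee_fin ler_pdivrMr // mulrC.
  by rewrite -ler_pdivrMr // ltW.
move: (fI x Bx) => [_] /=.
by case: ifP => _ fxh; [exact: le_trans fxh|exact: le_lt_trans fxh].
Qed.

(** The conditions on [f] hold up to null sets, since in the application the fibres are controlled
    only over [S]. The integral is cut down to the part [B] of [A] where [f] lies in [I]. If
    [mu B = 0], the product is [c0 * 0]. *)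
Lemma integral_in_interval_prod I J A f (c0 : \bar K) : measurable A ->
  measurable_fun setT f -> (forall x, 0 <= f x) ->
  mu (A `&` [set x | ~ in_interval I (f x)]) = 0 ->
  mu (~` A `&` [set x | f x != 0]) = 0 ->
  in_interval I c0 -> in_interval J (mu A) -> ~ infty_open I ->
  in_interval_prod I J (\int[mu]_x f x).
Proof.
move=> mA mf f0 nI n0 c0I JA nI'.
have mI : measurable (f @^-1` in_interval I).
  by rewrite -[X in measurable X]setTI; exact/mf/measurable_in_interval.
pose B := A `&` f @^-1` in_interval I.
have mB : measurable B by exact: measurableI.
have mAB : measurable (A `&` [set x | ~ in_interval I (f x)]).
  by apply: measurableI => //; exact: (measurableC mI).
have BA : mu B = mu A.
  rewrite [RHS](measureDI mu mA mI) [X in _ = X + _](_ : _ = 0) ?add0e //.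
have m0 : measurable (~` A `&` [set x | f x != 0]).
  apply: measurableI; first exact: measurableC.
  rewrite (_ : [set x | f x != 0] = ~` (f @^-1` [set 0])).
    apply: measurableC; rewrite -[X in measurable X]setTI; apply: mf => //.
  by apply/seteqP; split=> x /= /eqP.
(* Off [B], the function vanishes outside the union of the two null sets. *)
have -> : \int[mu]_x f x = \int[mu]_(x in B) f x.
  have NB0 : mu ((A `&` [set x | ~ in_interval I (f x)]) `|`
      (~` A `&` [set x | f x != 0])) = 0 by exact: null_set_setU.
  rewrite [RHS]integral_mkcond; apply: ge0_ae_eq_integral => //.
  - by apply/(measurable_restrictT _ _).1 => //; exact: measurable_funS mf.
  - by move=> x _; rewrite /patch; case: ifP.
  exists ((A `&` [set x | ~ in_interval I (f x)]) `|`
      (~` A `&` [set x | f x != 0])); split=> //; first exact: measurableU.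
  move=> x /= nx; apply: contrapT => nN; apply: nx => _.
  rewrite /patch; case: ifPn => // /negP nB; apply/eqP/negPn/negP => fx0.
  apply: nN; have [Ax|nAx] := pselect (A x); last by right.
  by left; split=> // Ifx; apply: nB; apply/mem_set.
have Bf x : B x -> in_interval I (f x) by case.
have mBf : measurable_fun B f by exact: measurable_funS mf.
have [B0|B0] := eqVneq (mu B) 0.
  exists c0, 0; rewrite mule0 null_set_integral //; split=> //.
  by split=> //; rewrite -B0 BA.
have B_gt0 : 0 < mu B by rewrite lt_neqAle eq_sym B0 /=.
have [Boo|Boo] := eqVneq (mu B) +oo.
  by apply: integral_in_interval_infty => //; rewrite -Boo BA.
have Boo' : mu B < +oo by rewrite lt_neqAle Boo leey.
have [c cI ->] := integral_in_interval_gt0 mB mBf (fun x _ => f0 x) Bf B_gt0 Boo' nI'.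
by exists c, (mu B); split=> //; rewrite BA.
Qed.

End MeanValue.

(** * Product measure and the reduction *)

Lemma open_baire_coord (i v : nat) : open [set p : baire | p i = v].
Proof.
rewrite (_ : [set p | _] = @proj nat (fun=> nat) i @^-1` [set v]) //.
by apply: open_comp => [x _|]; [exact: proj_continuous|exact: discrete_open].
Qed.

Lemma open_bpair_coord (i v : nat) :
  open [set rs : baire * baire | bpair rs.1 rs.2 i = v].
Proof.
rewrite /bpair; case: (odd i).
- rewrite (_ : [set _ | _] = snd @^-1` [set p : baire | p i./2 = v]) //.
  by apply: open_comp => [x _|]; [exact: cvg_snd|exact: open_baire_coord].
- rewrite (_ : [set _ | _] = fst @^-1` [set p : baire | p i./2 = v]) //.
  by apply: open_comp => [x _|]; [exact: cvg_fst|exact: open_baire_coord].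
Qed.

(** Measurability refers to the product of the two Borel sigma-algebras, so it comes from the
    projections and not from openness in the product topology. *)
Lemma measurable_bpair_coord (i v : nat) :
  measurable [set rs : borel_baire * borel_baire | bpair rs.1 rs.2 i = v].
Proof.
have mo (j : nat) : measurable ([set p | p j = v] : set borel_baire).
  by apply: sub_sigma_algebra; exact: open_baire_coord.
rewrite /bpair; case: (odd i).
- rewrite (_ : [set _ | _] = setT `&` snd @^-1` [set p | p i./2 = v]).
    exact: measurable_snd.
  by rewrite setTI.
- rewrite (_ : [set _ | _] = setT `&` fst @^-1` [set p | p i./2 = v]).
    exact: measurable_fst.
  by rewrite setTI.
Qed.

(** * Closed sets given by rejected prefixes *)

Definition cylinder (w : seq nat) : set (baire * baire) :=
  [set rs | mkseq (bpair rs.1 rs.2) (size w) = w].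

Lemma cylinder_rcons w v : cylinder (rcons w v) =
  cylinder w `&` [set rs | bpair rs.1 rs.2 (size w) = v].
Proof.
apply/seteqP; split=> rs; rewrite /cylinder /= size_rcons mkseqS.
  by move/eqP; rewrite eqseq_rcons => /andP[/eqP ? /eqP].
by move=> [-> ->].
Qed.

Lemma open_cylinder w : open (cylinder w).
Proof.
elim/last_ind: w => [|w v IH].
  by rewrite (_ : cylinder [::] = setT); [exact: openT|apply/seteqP].
by rewrite cylinder_rcons; apply: openI => //; exact: open_bpair_coord.
Qed.

Lemma measurable_cylinder w :
  measurable (cylinder w : set (borel_baire * borel_baire)).
Proof.
elim/last_ind: w => [|w v IH].
  by rewrite (_ : cylinder [::] = setT); [exact: measurableT|apply/seteqP].
by rewrite cylinder_rcons; apply: measurableI => //; exact: measurable_bpair_coord.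
Qed.

Definition avoids (b : seq nat -> bool) : set (baire * baire) :=
  [set rs | forall n, ~~ b (mkseq (bpair rs.1 rs.2) n)].

Lemma avoidsE b : avoids b = ~` \bigcup_(w in [set w | b w]) cylinder w.
Proof.
apply/seteqP; split=> rs /=.
  by move=> H [w /= bw rsw]; have := H (size w); rewrite rsw bw.
move=> H n; apply/negP => bn; apply: H; exists (mkseq (bpair rs.1 rs.2) n) => //.
by rewrite /cylinder /= size_mkseq.
Qed.

Lemma closed_avoids b : closed (avoids b).
Proof.
rewrite avoidsE; apply: open_closedC; apply: bigcup_open => w _.
exact: open_cylinder.
Qed.

(** Finite sequences are countable, so the complement is a countable union of cylinders. *)
Lemma measurable_avoids b :
  measurable (avoids b : set (borel_baire * borel_baire)).
Proof.
rewrite avoidsE; apply: measurableC; rewrite bigcup_mkcond.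
apply: countable_bigcupT_measurable; first exact: countableP.
by move=> w; case: ifP => _; [exact: measurable_cylinder|exact: measurable0].
Qed.

(* Carries the sigma-finite instance given by a proof of sigma-finiteness. *)
Definition sigma_finite_copy (K : realType) (d : measure_display)
    (T : measurableType d) (m : {measure set T -> \bar K})
    (sf : sigma_finite setT m) : set T -> \bar K := m.

Section SigmaFiniteCopy.
Variables (K : realType) (d : measure_display) (T : measurableType d).
Variables (m : {measure set T -> \bar K}) (sf : sigma_finite setT m).

HB.instance Definition _ := Measure.copy (sigma_finite_copy sf) m.
HB.instance Definition _ :=
  Measure_isSigmaFinite.Build _ _ _ (sigma_finite_copy sf) sf.

End SigmaFiniteCopy.

(** * Integration along sections, and measures concentrated on a subspace *)

Section Tonelli.
Variables (K : realType) (d1 d2 : measure_display).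
Variables (T1 : measurableType d1) (T2 : measurableType d2).
Variables (m1 : {measure set T1 -> \bar K}) (m2 : {measure set T2 -> \bar K}).
Hypotheses (sf1 : sigma_finite setT m1) (sf2 : sigma_finite setT m2).
Local Open Scope ereal_scope.

Lemma measurable_fun_measure_ysection (C : set (T1 * T2)) : measurable C ->
  measurable_fun setT (fun y => m1 (ysection C y)).
Proof. by move=> mC; exact: (measurable_fun_ysection (sigma_finite_copy sf1) mC). Qed.

(** The product measure unfolds to an integral over the first factor; Tonelli for the indicator of
    [C] exchanges the order. *)
Lemma product_measure_ysection (C : set (T1 * T2)) : measurable C ->
  (m1 \x m2) C = \int[m2]_y m1 (ysection C y).
Proof.
move=> mC.
have := indic_fubini_tonelli (sigma_finite_copy sf1) (sigma_finite_copy sf2) mC.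
by rewrite indic_fubini_tonelli_FE // indic_fubini_tonelli_GE.
Qed.

End Tonelli.

Section Concentrated.
Variables (K : realType) (R : set baire).
Variables (nu : {measure set borel_baire -> \bar K}).
Hypothesis cR : concentrated_on nu R.

(** Two Borel sets with the same trace on [R] differ by sets missing [R], which are null; so the
    measure of a trace is well defined. *)
Lemma concentrated_eq (B B' : set borel_baire) : measurable B -> measurable B' ->
  B `&` R = B' `&` R -> nu B = nu B'.
Proof.
move=> mB mB' BB'.
have D0 (D D' : set borel_baire) : measurable D -> measurable D' ->
    D `&` R = D' `&` R -> nu (D `\` D') = 0%E.
  move=> mD mD' DD'; apply: cR; first exact: measurableD.
  apply/seteqP; split=> // x [[Dx nD'x] Rx]; apply: nD'x.
  by have : (D `&` R) x by []; rewrite DD' => -[].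
have E (D D' : set borel_baire) : measurable D -> measurable D' ->
    D `&` R = D' `&` R -> nu D = nu (D `&` D').
  move=> mD mD' DD'; apply: etrans (measureDI nu mD mD') _.
  by rewrite [X in (X + _)%E](D0 D D') ?add0e.
by rewrite (E B B') // (E B' B) // setIC.
Qed.

End Concentrated.

(** The hypotheses on fibres concern points of [S]; the exceptional sets are Borel and miss [S],
    hence are null for [nuS]. *)
Lemma product_measure_in_interval_prod (K : realType) (R S : set baire)
    (nuR nuS : {measure set borel_baire -> \bar K}) (I J : xinterval K)
    (A : set borel_baire) (C : set (borel_baire * borel_baire)) (c : \bar K) :
  sigma_finite setT nuR -> concentrated_on nuR R ->
  sigma_finite setT nuS -> concentrated_on nuS S -> ~ infty_open I ->
  measurable A -> measurable C -> in_interval I c -> in_interval J (nuS A) ->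
  (forall s, S s -> A s -> exists2 B : set borel_baire, measurable B &
     B `&` R = ysection C s `&` R /\ in_interval I (nuR B)) ->
  (forall s, S s -> ~ A s -> ysection C s `&` R = set0) ->
  in_interval_prod I J ((nuR \x nuS)%E C).
Proof.
move=> sfR cR sfS cS nI mA mC cI JA inA outA.
have mf := measurable_fun_measure_ysection sfR mC.
have mI : measurable ((fun y => nuR (ysection C y)) @^-1` in_interval I).
  by rewrite -[X in measurable X]setTI; apply: mf => //; exact: measurable_in_interval.
have mys s : measurable (ysection C s) by exact: measurable_ysection.
rewrite product_measure_ysection //; apply: (@integral_in_interval_prod
  _ _ _ _ I J A _ c) => //.
- apply: cS.
    by apply: measurableI => //; exact: (measurableC mI).
  apply/seteqP; split=> // s [[As /= nIs] Ss]; apply: nIs.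
  have [B mB [BR IB]] := inA s Ss As.
  by rewrite -(concentrated_eq cR mB (mys s) BR).
- apply: cS.
    apply: measurableI; first exact: measurableC.
    rewrite (_ : [set x | _] =
      ~` ((fun y => nuR (ysection C y)) @^-1` [set 0%E])).
      apply: measurableC; by rewrite -[X in measurable X]setTI; apply: mf.
    by apply/seteqP; split=> x /= /eqP.
  apply/seteqP; split=> // s [[nAs /= /eqP nz] Ss]; apply: nz.
  by rewrite (concentrated_eq cR (mys s) measurable0) ?measure0 // outA // set0I.
Qed.

(** * Names of closed sets and reductions to choice *)

Lemma eta_fun p r q q' : eta p r q -> eta p r q' -> q = q'.
Proof.
move=> H H'; apply/funext => n; have [m [E L]] := H n; have [m' [E' L']] := H' n.
have [mm|mm|mm] := ltngtP m m'.
- by rewrite L' in E.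
- by rewrite L in E'.
- by apply: succn_inj; rewrite -E -E' mm.
Qed.

Lemma dnegP X (dX : baire -> X -> Prop) p (A : set X) r x :
  dneg dX p A -> dX r x ->
  exists2 q, eta p r q & (~ A x <-> exists n, q n <> 0%N).
Proof.
move=> [_ Ad] /Ad[q [eq b]]; exists q => //.
move: b; rewrite /dsier -asbool_neg => E; split=> [|[n qn]].
  by move=> /asboolP; rewrite E => /asboolP nq; exact/existsNP.
by apply/asboolP; rewrite E; apply/asboolP => q0; exact: qn.
Qed.

(** The first clause of [dneg] confines both sets to points with names, where the common name
    decides membership. *)
Lemma dneg_fun X (dX : baire -> X -> Prop) p A B :
  dneg dX p A -> dneg dX p B -> A = B.
Proof.
move=> pA pB.
have H x : (exists r, dX r x) -> A x <-> B x.
  move=> [r rx]; have [q eq qA] := dnegP pA rx; have [q' eq' qB] := dnegP pB rx.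
  rewrite (eta_fun eq eq') -qB in qA.
  by split=> Hx; apply: contrapT => nH; [exact: (qA.2 nH)|exact: (qA.1 nH)].
by apply/seteqP; split=> x Hx; apply/H => //; [exact: pA.1|exact: pB.1].
Qed.

Section ChoiceReduction.
Variables (R : set baire) (g : problem (set baire) baire).
Hypothesis gR : forall A a, g A a -> R a.

Definition in_dom (q : baire) : Prop :=
  exists Aa : set baire * baire, dneg (dsub R) q Aa.1 /\ g Aa.1 Aa.2.

Definition choose_realizer : pfun := fun q =>
  if pselect (in_dom q) is left H then Some (sval (cid H)).2 else None.

Lemma choose_realizer_realizes : realizes (dneg (dsub R)) (dsub R) g choose_realizer.
Proof.
move=> q A qA [a gAa]; rewrite /choose_realizer.
case: pselect => [H|]; last by case; exists (A, a).
case: cid => -[B b] /= [qB gBb]; exists b, b; split=> //.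
by rewrite (dneg_fun qA qB); split=> //; split=> //; exact: gR gBb.
Qed.

Lemma override_realizes G e A a : realizes (dneg (dsub R)) (dsub R) g G ->
  dneg (dsub R) e A -> g A a ->
  realizes (dneg (dsub R)) (dsub R) g
    (fun q => if `[< q = e >] then Some a else G q).
Proof.
move=> Gr eA gAa q B qB dB; case: asboolP => [qe|_]; last exact: Gr.
have eB : dneg (dsub R) e B by rewrite -qe.
exists a, a; split=> //; rewrite -(dneg_fun eA eB).
by split=> //; split=> //; exact: gR gAa.
Qed.

(* The domain of [K] is forced by testing against a realizer that is undefined
   off the names of instances, the values of [H] by letting realizers select
   each solution. *)
Lemma choice_reductionP (X Y : Type) (dX : baire -> X -> Prop)
    (dY : baire -> Y -> Prop) (f : problem X Y) (H K : pfun) p x :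
  (forall G, realizes (dneg (dsub R)) (dsub R) g G -> realizes dX dY f
     (fun p => obind (fun q => obind (fun r => H (bpair p r)) (G q)) (K p))) ->
  dX p x -> (exists y, f x y) ->
  exists e A, [/\ K p = Some e, dneg (dsub R) e A, exists a, g A a &
    forall a, g A a -> exists q y, [/\ H (bpair p a) = Some q, dY q y & f x y]].
Proof.
move=> HK px dom.
have := HK _ choose_realizer_realizes p x px dom.
move=> [q [y [E _]]]; case Kp: (K p) E => [e|] //= E.
have [[A a] /= [eA gAa]] : in_dom e.
  by move: E; rewrite /choose_realizer; case: pselect.
exists e, A; split=> //; first by exists a.
move=> a' gAa'.
have := HK _ (override_realizes choose_realizer_realizes eA gAa') p x px dom.
move=> [q' [y' [E' [qy fxy]]]]; exists q', y'; split=> //.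
by move: E'; rewrite Kp /= asboolT.
Qed.

End ChoiceReduction.

Lemma PC_mem (K : realType) (I : \bar K -> Prop) R
    (nu : {measure set borel_baire -> \bar K}) A a : PC I R nu A a -> R a.
Proof. by move=> [[C [_ ->]] [_ []]]. Qed.

(** * The reduction to choice on the product *)

Unset Implicit Arguments.

Theorem theorem4p3 (K : realType) (R S : set baire)
    (nuR nuS : {measure set borel_baire -> \bar K})
    (I J : xinterval K) :
  sigma_finite setT nuR -> concentrated_on nuR R ->
  sigma_finite setT nuS -> concentrated_on nuS S ->
  ~ infty_open I ->
  cprod_wred
    (dneg (dsub R)) (dsub R) (PC (in_interval I) R nuR)
    (dneg (dsub S)) (dsub S) (PC (in_interval J) S nuS)
    (dneg (dprod (dsub R) (dsub S))) (dprod (dsub R) (dsub S))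
    (PC2 (in_interval_prod I J) R S nuR nuS).
Proof.
move=> sfR cR sfS cS nI X Y Z f0 g0 [H1 [K1 [cH1 [cK1 red1]]]].
move=> [H2 [K2 [cH2 [cK2 red2]]]].
have [k [b [[ck etak acc2 acc acc1]]]] := composite_name cK2 cH2 cK1.
exists (fun w => obind (fun y => H1 (bpair y (bfst (bsnd w))))
                       (H2 (bpair (bfst w) (bsnd (bsnd w))))).
exists (fun p => Some (k p)).
split; first exact: computable_composite_output.
split=> // G Gr p x px [_ [domf [y0 [g0y0 _]]]].
have [e [A [K2p eA [s0 PCs0] solA]]] := choice_reductionP
  (@PC_mem _ _ _ _) red2 px (ex_intro _ y0 g0y0).
have [clA [[A' [mA' [A'S JA']]] As0]] := PCs0.
have AS s : A s -> S s by rewrite -A'S => -[].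
(* For [s] in [A] the whole chain is defined: [H2] yields a name of some [y] in [g0 x], by [domf]
   this [y] is in the domain of [f0], and the outer reduction supplies the set [B]. *)
have sol s : A s -> exists q y e' B, [/\ H2 (bpair p s) = Some q,
    g0 x y, K1 q = Some e', dneg (dsub R) e' B &
    (exists r, PC (in_interval I) R nuR B r) /\
    forall r, B r -> exists w z,
      [/\ H1 (bpair q r) = Some w, rdelta w z & f0 y z]].
  move=> As; have [|q [y [H2q qy gy]]] := solA s.
    by split=> //; split=> //; exists A'.
  have [e' [B [K1q eB [r PCr] solB]]] := choice_reductionP
    (@PC_mem _ _ _ _) red1 qy (domf y gy).
  exists q, y, e', B; split=> //; split; first by exists r.
  move=> r' Br'; apply: solB; have [clB [IB _]] := PCr.
  by split.
pose C0 : set (baire * baire) := avoids (b p).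
have C0A r s : S s -> C0 (r, s) -> A s.
  move=> Ss C0rs; apply: contrapT => nAs.
  have [q eq qA] := dnegP eA (conj Ss erefl).
  rewrite -(bsnd_bpair r s) in eq.
  have [n bn] := acc2 p (bpair r s) e q K2p eq (qA.1 nAs).
  by have := C0rs n; rewrite /= bn.
(* Over [s] in [A] the first test never rejects, so rejection can only come from [B]. *)
have C0B r s q e' B : R r -> A s -> H2 (bpair p s) = Some q ->
    K1 q = Some e' -> dneg (dsub R) e' B -> C0 (r, s) <-> B r.
  move=> Rr As H2q K1q eB.
  have [qs eqs qsA] := dnegP eA (conj (AS s As) erefl).
  have [qr eqr qrB] := dnegP eB (conj Rr erefl).
  rewrite -(bsnd_bpair r s) in eqs H2q; rewrite -(bfst_bpair r s) in eqr.
  split=> [C0rs|Br].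
    apply: contrapT => nBr.
    have [n bn] := acc1 _ _ _ _ _ H2q K1q eqr (qrB.1 nBr).
    by have := C0rs n; rewrite /= bn.
  move=> n; apply/negP => bn.
  have [] := acc _ _ _ _ _ _ _ K2p eqs H2q K1q eqr (ex_intro _ n bn).
    by move=> /qsA.
  by move=> /qrB.
pose C := C0 `&` (R `*` S).
have kC : dneg (dprod (dsub R) (dsub S)) (k p) C.
  split=> [[r s] [_ [Rr Ss]]|w [r s] [[Rr /= ->] [Ss ->]]].
    by exists (bpair r s); rewrite /dprod /dsub /= bfst_bpair bsnd_bpair.
  exists (fun n => b p (mkseq w n) : nat); split; first exact: etak.
  rewrite /dsier -asbool_neg; apply/asbool_equiv_eq; split.
    move=> nC nb; apply: nC; split=> // n /=.
    by have := nb n; rewrite bpair_eta; case: (b p _).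
  move=> nb [C0w _]; apply: nb => n; have := C0w n.
  by rewrite /= bpair_eta => /negbTE ->.
have PC2C r s : C (r, s) ->
    PC2 (in_interval_prod I J) R S nuR nuS C (r, s).
  move=> Crs; split.
    by exists C0; split=> //; exact: closed_avoids.
  split=> //; exists C0; split; first exact: measurable_avoids.
  split=> //.
  (* The fibre over [s0] provides an element of [I]. *)
  have [q [y [e' [B [H2q _ K1q eB [[r0 [_ [[B' [_ [_ IB']]] _]]] _]]]]]] := sol s0 As0.
  apply: (product_measure_in_interval_prod (R := R) (S := S) (A := A')
    (c := nuR B')) => //; first exact: measurable_avoids.
    move=> s' Ss' A's'; have As' : A s' by rewrite -A'S.
    have [q' [y' [e2 [B2 [H2q' _ K1q' eB2 [[r2 PCr2] _]]]]]] := sol s' As'.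
    have [_ [[B2' [mB2' [B2R IB2]]] _]] := PCr2.
    exists B2' => //; split=> //; rewrite B2R; apply/seteqP; split=> r'.
      move=> B2r'; have Rr' : R r' by move: B2r'; rewrite -B2R => -[].
      split=> //; apply: mem_set.
      exact/(C0B _ _ _ _ _ Rr' As' H2q' K1q' eB2).
    by move=> [/set_mem C0r' Rr']; apply/(C0B _ _ _ _ _ Rr' As' H2q' K1q' eB2).
  move=> s' Ss' nA's'; apply/seteqP; split=> // r' [/set_mem C0r' _].
  by apply: nA's'; have := C0A _ _ Ss' C0r'; rewrite -A'S => -[].
(* A point of the fibre over [s0] makes [C] nonempty, so [G] must answer on [k p]. *)
have [q0 [y1 [e' [B [H2q0 _ K1q0 eB [[r0 PCr0] _]]]]]] := sol s0 As0.
have Rr0 := PC_mem PCr0; have [_ [_ Br0]] := PCr0.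
have C00 : C (r0, s0).
  split; last by split=> //; exact: AS.
  exact/(C0B _ _ _ _ _ Rr0 As0 H2q0 K1q0 eB).
have [w [[r s] [Gk [[[Rr /= rE] [Ss /= sE]] [_ [_ [C0rs _]]]]]]] :=
  Gr _ _ kC (ex_intro _ _ (PC2C _ _ C00)).
rewrite -rE in Rr; rewrite -sE in Ss; have As := C0A _ _ Ss C0rs.
(* The answer of [G] may lie over another point than [s0], so the chain is taken at its own [s]. *)
have [q [y [e2 [B2 [H2q gy K1q eB2 [_ solB]]]]]] := sol s As.
have Br : B2 r by apply/(C0B _ _ _ _ _ Rr As H2q K1q eB2).
have [v [z [H1v vz fyz]]] := solB r Br.
exists v, z; split.
  by rewrite /= Gk /= bfst_bpair bsnd_bpair -rE -sE H2q /= H1v.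
by split=> //; split=> //; exists y.
Qed.
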